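(* Let $\Omega\subset\mathbb{R}^n$ be a bounded domain with smooth boundary $\partial\Omega$, let $\omega$ be an open subset of $\Omega$, and let $T>0$. Assume that all eigenvalues $\mu_j$, $j\ge1$, of the Dirichlet Laplacian $A=\Delta$ on $L^2(\Omega)$, with domain $D(A)=H^1_0(\Omega)\cap H^2(\Omega)$, are simple, and let $(\varphi_j)_{j\ge 1}$ be a Hilbert (orthonormal) basis of $L^2(\Omega)$ with $\varphi_j$ an eigenfunction of $A$ associated with $\mu_j$. Then the heat equation with lumped control $$\begin{cases} z_t(x,t)=\Delta z(x,t)+\mathbf{1}_\omega(x) u(t), & (x,t)\in\Omega\times(0,T),\\ z(x,t)=0, & (x,t)\in\partial\Omega\times(0,T),\\ z(x,0)=z_0(x), & x\in\Omega,\end{cases}$$ with controls $u\in L^2(0,T;\mathbb{R})$ depending only on time, is approximately controllable at time $T$ on $L^2(\Omega)$ if and only if $$\int_\omega \varphi_j(x)\,dx\neq 0\qquad\text{for all } j\ge 1 .$$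
   Context: $L^2(\Omega)$ is the space of real-valued square integrable functions, $\mathbf{1}_\omega$ is the characteristic function of $\omega$, and $S(t)$ denotes the $C_0$-semigroup generated by $A$ on $H=L^2(\Omega)$. The solution is the mild solution $z(t)=S(t)z_0+\int_0^t S(t-s)Bu(s)\,ds$, where $B:\mathbb{R}\to L^2(\Omega)$ is $B\lambda=\lambda\mathbf{1}_\omega$. The system is approximately controllable at time $T$ if for all $z_0,z_1\in H$ and every $\varepsilon>0$ there is a control $u\in L^2(0,T;\mathbb{R})$ such that the corresponding mild solution satisfies $\|z(T)-z_1\|_{L^2(\Omega)}\le\varepsilon$. *)

(* Defs.v *)
From HB Require Import structures.
From mathcomp Require Import all_boot all_order all_algebra.
From mathcomp Require Import all_classical all_reals all_analysis.
From mathcomp Require Import measurable_realfun.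

Set Implicit Arguments.
Unset Strict Implicit.
Unset Printing Implicit Defensive.
Import Order.TTheory GRing.Theory Num.Theory.
Import numFieldNormedType.Exports.

Local Open Scope classical_set_scope.
Local Open Scope ring_scope.

(* The Borel sigma-algebra of R^n, generated by the coordinate functions. *)
Definition rV_display : measure_display. Proof. by constructor. Qed.

Section rV_measurable.
Context (R : realType) (n : nat).

Definition rV_coord (i : 'I_n) (x : 'rV[R]_n) : R := x 0 i.

Let rV_set0 : g_sigma_preimage rV_coord set0.
Proof. exact: sigma_algebra0. Qed.

Let rV_setC A : g_sigma_preimage rV_coord A -> g_sigma_preimage rV_coord (~` A).
Proof. exact: sigma_algebraC. Qed.

Let rV_bigcup (F : (set 'rV[R]_n)^nat) :
  (forall i, g_sigma_preimage rV_coord (F i)) ->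
  g_sigma_preimage rV_coord (\bigcup_i (F i)).
Proof. exact: sigma_algebra_bigcup. Qed.

HB.instance Definition _ := @isMeasurable.Build rV_display
  'rV[R]_n (g_sigma_preimage rV_coord) rV_set0 rV_setC rV_bigcup.

Lemma measurable_rV_coord (i : 'I_n) : measurable_fun setT (rV_coord i).
Proof.
move=> _ Y mY; rewrite setTI; apply: sub_sigma_algebra => /=.
rewrite -bigcup_seq/=; exists i => /=; first by rewrite mem_index_enum.
by exists Y => //; rewrite setTI.
Qed.

Lemma measurable_fun_rV d (T : measurableType d) (f : T -> 'rV[R]_n) :
  (forall i, measurable_fun setT (fun x => f x 0 i)) -> measurable_fun setT f.
Proof.
move=> mf _ A mA; rewrite setTI.
suff: g_sigma_preimage rV_coord `<=` [set B | measurable (f @^-1` B)] by exact.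
apply: smallest_sub => /=.
  split => /=.
  - by rewrite preimage_set0; exact: measurable0.
  - by move=> B mB; rewrite setTD -preimage_setC; exact: measurableC.
  - by move=> F mF; rewrite preimage_bigcup; exact: bigcupT_measurable.
rewrite -bigcup_seq => B [i _ [C mC <-]]; rewrite /= setTI -comp_preimage.
by rewrite -[X in measurable X]setTI; exact: mf.
Qed.

Lemma open_measurable_rV (U : set 'rV[R]_n) : open U -> measurable U.
Proof.
move=> oU.
pose c (q : 'rV[rat]_n) : 'rV[R]_n := map_mx ratr q.
pose B (p : 'rV[rat]_n * nat) : set 'rV[R]_n := ball (c p.1) p.2.+1%:R^-1.
have -> : U = \bigcup_(p in [set p | B p `<=` U]) B p.
  apply/seteqP; split=> [x Ux|x [p pU /pU//]].
  have /nbhs_ballP[e /= e0 xeU] : nbhs x U by exact: open_nbhs_nbhs.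
  have [k ke] : exists k : nat, k.+1%:R^-1 < e / 2.
    have e20 : 0 < e / 2 by rewrite divr_gt0.
    have [k _ ke] := near_infty_natSinv_lt (PosNum e20).
    by exists k; exact: (ke k) (leqnn k).
  pose d : R := k.+1%:R^-1.
  have d0 : 0 < d by rewrite invr_gt0.
  have /choice[q qP] : forall j : 'I_n, exists q : rat, ball (x 0 j) d (ratr q).
    move=> j; have := @dense_rat R (ball (x 0 j) d).
    case; [by exists (x 0 j); exact: ballxx|exact: ball_open|].
    by move=> y [xy [q _ qy]]; exists q; rewrite qy.
  have xq : ball (c (\row_j q j)) d x.
    split => // i j; rewrite !mxE ord1; apply: ball_sym; exact: qP.
  exists (\row_j q j, k) => //= y qy; apply: xeU.
  have dde : d + d <= e by rewrite (splitr e) lerD// ltW.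
  apply: (le_ball dde); by apply: ball_triangle qy; exact: ball_sym.
have mB p : measurable (B p).
  rewrite (_ : B p = \bigcap_(j in [set: 'I_n])
      (rV_coord j @^-1` ball (c p.1 0 j) p.2.+1%:R^-1)).
    apply: fin_bigcap_measurable => // j _.
    rewrite -[X in measurable X]setTI; apply: measurable_rV_coord => //.
    exact: measurable_ball.
  apply/seteqP; split=> x.
    by move=> [_ +] j _; exact.
  by move=> xB; split=> [|i j]; [rewrite invr_gt0|rewrite ord1; exact: xB].
rewrite bigcup_mkcond; apply: countable_bigcupT_measurable => // p.
by case: ifP.
Qed.
End rV_measurable.

Section lebesgue_rV_step.
Context (R : realType) (n : nat).
Variable m : {sigma_finite_measure set 'rV[R]_n -> \bar R}.

Definition rV_cons (p : R * 'rV[R]_n) : 'rV[R]_n.+1 := row_mx p.1%:M p.2.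

Lemma rV_cons0 p : rV_cons p 0 0 = p.1.
Proof.
have -> : rV_cons p 0 0 = rV_cons p 0 (lshift n (0 : 'I_1)).
  by congr (rV_cons p 0 _); exact/val_inj.
by apply: etrans (row_mxEl _ _ _ _) _; rewrite mxE.
Qed.

Lemma rV_consS p j : rV_cons p 0 (lift 0 j) = p.2 0 j.
Proof.
rewrite /rV_cons (_ : lift 0 j = rshift 1 j); last exact/val_inj.
exact: row_mxEr.
Qed.

Lemma measurable_rV_cons : measurable_fun setT rV_cons.
Proof.
apply: measurable_fun_rV => i; case: (unliftP 0 i) => [j ->|->].
  under eq_fun do rewrite rV_consS.
  exact: (measurableT_comp (measurable_rV_coord j)).
by under eq_fun do rewrite rV_cons0; exact: measurable_fst.
Qed.

Definition lebesgue_rV_succ : set 'rV[R]_n.+1 -> \bar R :=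
  pushforward (lebesgue_measure \x m)%E rV_cons.

Let succ0 : lebesgue_rV_succ set0 = 0%E.
Proof. by apply: measure0 => //; exact: measurable_rV_cons. Qed.

Let succ_ge0 A : (0 <= lebesgue_rV_succ A)%E.
Proof. by apply: measure_ge0; exact: measurable_rV_cons. Qed.

Let succ_sigma_additive : semi_sigma_additive lebesgue_rV_succ.
Proof. by apply: measure_semi_sigma_additive; exact: measurable_rV_cons. Qed.

HB.instance Definition _ := isMeasure.Build _ _ _ lebesgue_rV_succ
  succ0 succ_ge0 succ_sigma_additive.

Let succ_sigma_finite : sigma_finite setT lebesgue_rV_succ.
Proof.
have /sigma_finiteP[F [FT ndF Foo]] := sigma_finiteT (@lebesgue_measure R).
have /sigma_finiteP[G [GT ndG Goo]] := sigma_finiteT m.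
pose g (x : 'rV[R]_n.+1) : R * 'rV[R]_n := (x 0 0, \row_j x 0 (lift 0 j)).
have mg : measurable_fun setT g.
  apply/measurable_fun_pairP; split => /=.
    exact: (measurable_rV_coord (0 : 'I_n.+1)).
  apply: measurable_fun_rV => i /=; under eq_fun do rewrite mxE.
  exact: (measurable_rV_coord (lift 0 i)).
have gK p : g (rV_cons p) = p.
  case: p => a v; congr pair; first exact: rV_cons0.
  by apply/rowP => j; rewrite mxE rV_consS.
exists (fun k => g @^-1` (F k `*` G k)).
  apply/seteqP; split=> // x _.
  have [i _ Fi] : (\bigcup_i F i) (g x).1 by rewrite -FT.
  have [j _ Gj] : (\bigcup_i G i) (g x).2 by rewrite -GT.
  exists (maxn i j) => //; split.
    by move: Fi; exact/subsetPset/ndF/leq_maxl.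
  by move: Gj; exact/subsetPset/ndG/leq_maxr.
move=> k; have [mF Fk] := Foo k; have [mG Gk] := Goo k; split.
  by rewrite -[X in measurable X]setTI; apply: mg => //; exact: measurableX.
rewrite /lebesgue_rV_succ /pushforward -comp_preimage.
rewrite (_ : g \o rV_cons = id); last by apply/funext => p /=.
rewrite preimage_id.
change ((lebesgue_measure \x m)%E (F k `*` G k) < +oo)%E.
by rewrite product_measure1E// lte_mul_pinfty// ge0_fin_numE.
Qed.

HB.instance Definition _ := Measure_isSigmaFinite.Build _ _ _ lebesgue_rV_succ
  succ_sigma_finite.
End lebesgue_rV_step.

(* Lebesgue measure on R^n, as an iterated product of the one-dimensional one;
   R^0 carries the unit mass. *)
Fixpoint lebesgue_rV (R : realType) (n : nat) :
    {sigma_finite_measure set 'rV[R]_n -> \bar R} :=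
  match n with
  | 0 => @dirac _ 'rV[R]_0 0 R
  | n'.+1 => lebesgue_rV_succ (lebesgue_rV R n')
  end.

Lemma lebesgue_rV_box (R : realType) (n : nat) (I : 'I_n -> interval R) :
  (lebesgue_rV R n [set x : 'rV[R]_n | forall i, x 0%R i \in I i] =
   \prod_(i < n) lebesgue_measure [set` I i])%E.
Proof.
elim: n => [|n IHn] in I *.
  rewrite big_ord0 /= (_ : [set _ | _] = setT) ?diracT//.
  by apply/seteqP; split => // x _ [].
pose B := [set x : 'rV[R]_n | forall i, x 0 i \in I (lift 0 i)].
have mB : measurable B.
  rewrite (_ : B = \bigcap_(i in [set: 'I_n])
      (rV_coord i @^-1` [set` I (lift 0 i)])).
    apply: fin_bigcap_measurable => // i _.
    by rewrite -[X in measurable X]setTI; exact: measurable_rV_coord.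
  by apply/seteqP; split=> x xB i; [move=> _|]; exact: xB.
rewrite big_ord_recl -IHn -product_measure1E//; congr (product_measure1 _ _ _).
apply/seteqP; split=> -[a v] /=.
  move=> avI; split=> [|i]; first by have := avI 0; rewrite rV_cons0.
  by have := avI (lift 0 i); rewrite rV_consS.
move=> [aI vI] i.
by case: (unliftP 0 i) => [j ->|->]; rewrite ?rV_consS ?rV_cons0; [exact: vI|].
Qed.

Lemma lebesgue_rV_bounded (R : realType) (n : nat) (A : set 'rV[R]_n) :
  measurable A -> bounded_set A -> (lebesgue_rV R n A < +oo)%E.
Proof.
move=> mA [M [_ /(_ (M + 1))]]; rewrite ltrDl ltr01 => /(_ isT) AM.
pose B := [set x : 'rV[R]_n | forall i, x 0 i \in `[- (M + 1), M + 1]].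
have mB : measurable B.
  rewrite (_ : B = \bigcap_(i in [set: 'I_n])
      (rV_coord i @^-1` `[- (M + 1), M + 1])).
    apply: fin_bigcap_measurable => // i _.
    by rewrite -[X in measurable X]setTI; exact: measurable_rV_coord.
  by apply/seteqP; split=> x xB i; [move=> _|]; exact: xB.
apply: (@le_lt_trans _ _ (lebesgue_rV R n B)).
  apply: le_measure; rewrite ?inE// => x /AM /= xM i.
  rewrite in_itv /= -ler_norml; apply: le_trans xM.
  rewrite {2}/Num.norm /= mx_normrE.
  exact: (le_bigmax _ (fun ij => `|x ij.1 ij.2|) (0, i)).
rewrite -ge0_fin_numE ?measure_ge0// lebesgue_rV_box.
apply: (big_ind (fun x => x \is a fin_num)) => //; first exact: fin_numM.
by move=> i _; rewrite lebesgue_measure_itv/=; case: ifP; rewrite -?EFinB.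
Qed.

(* Elements of L2 mu are square-integrable functions, not classes: equality in
   the Hilbert space is equality almost everywhere, f = g %[ae mu]. Bounded
   operators are maps on representatives that are linear almost everywhere and
   bounded for the seminorm, hence descend to classes. *)
Section L2.
Context d (T : measurableType d) (R : realType).
Variable mu : {measure set T -> \bar R}.

Definition L2 := LfunType mu (@lee1n R 2).

Definition L2norm (f : T -> R) : R := fine ('N[mu]_2%:E[EFin \o f])%E.

Definition L2dot (f g : T -> R) : R := \int[mu]_x (f x * g x).

Definition hilbert_basis (phi : nat -> L2) : Prop :=
  (forall i j, L2dot (phi i) (phi j) = (i == j)%:R) /\
  (forall (f : L2) (e : R), 0 < e -> exists (N : nat) (c : 'I_N -> R),
    L2norm (f - \sum_(j < N) c j *: phi j) <= e).

(* An unbounded operator A is given by its graph: A f g means that f is in the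
   domain and A f = g. *)
Definition is_eigenfunction (A : L2 -> L2 -> Prop) (lambda : R) (phi : L2) : Prop :=
  ~ (phi = cst 0 %[ae mu]) /\ A phi (lambda *: phi).

Definition is_eigenvalue (A : L2 -> L2 -> Prop) (lambda : R) : Prop :=
  exists phi, is_eigenfunction A lambda phi.

Definition is_simple_eigenvalue (A : L2 -> L2 -> Prop) (lambda : R) : Prop :=
  is_eigenvalue A lambda /\
  forall phi psi, is_eigenfunction A lambda phi -> is_eigenfunction A lambda psi ->
    exists c : R, psi = c *: phi %[ae mu].

Record C0_semigroup (S : R -> L2 -> L2) : Prop := C0Semigroup {
  semigroup_linear : forall (t a : R) (f g : L2), 0 <= t ->
    S t (a *: f + g) = a *: S t f + S t g %[ae mu];
  semigroup_bounded : forall t : R, 0 <= t ->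
    exists C : R, forall f, L2norm (S t f) <= C * L2norm f;
  semigroup0 : forall f, S 0 f = f %[ae mu];
  semigroupD : forall (s t : R) (f : L2), 0 <= s -> 0 <= t ->
    S (s + t) f = S s (S t f) %[ae mu];
  semigroup_continuous : forall f, L2norm (S t f - f) @[t --> 0^'+] --> (0 : R)
}.

Definition generated_by (S : R -> L2 -> L2) (A : L2 -> L2 -> Prop) : Prop :=
  forall z w, A z w <->
    L2norm (h^-1 *: (S h z - z) - w) @[h --> 0^'+] --> (0 : R).

Record simple_map (D : set R) := SimpleMap {
  sm_size : nat;
  sm_set : 'I_sm_size -> set (measurableTypeR R);
  sm_val : 'I_sm_size -> L2;
  sm_measurable : forall i, measurable (sm_set i);
  sm_finite : forall i, (lebesgue_measure (D `&` sm_set i) < +oo)%E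
}.
Arguments sm_set {D} s i.
Arguments sm_val {D} s i.

Definition sm_eval (D : set R) (s : simple_map D) (x : R) : L2 :=
  \sum_i \1_(sm_set s i) x *: sm_val s i.

Definition sm_integral (D : set R) (s : simple_map D) : L2 :=
  \sum_i fine (lebesgue_measure (D `&` sm_set s i)) *: sm_val s i.

(* g is Bochner integrable on D for Lebesgue measure, with integral y: it is an
   L^1 limit of simple maps whose integrals converge to y. *)
Definition is_bochner_integral (D : set R) (g : R -> L2) (y : L2) : Prop :=
  exists s : nat -> simple_map D,
  [/\ forall k, lebesgue_measure.-integrable D
        (fun x => (L2norm (g x - sm_eval (s k) x))%:E),
      (\int[lebesgue_measure]_(x in D) L2norm (g x - sm_eval (s k) x))
        @[k --> \oo] --> (0 : R)
    & L2norm (y - sm_integral (s k)) @[k --> \oo] --> (0 : R)].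

End L2.

Section control.
Context d (X : measurableType d) (R : realType).
Variables (mu : {measure set X -> \bar R}) (S : R -> L2 mu -> L2 mu).
Variables (B : R -> L2 mu) (T : R).

(* L^2(0, T; R) *)
Definition control : Type :=
  L2 (mrestr (@lebesgue_measure R) (measurable_itv `]0, T[)).

Definition mild_solution (u : control) (z0 : L2 mu) (z : R -> L2 mu) : Prop :=
  forall t : R, 0 <= t <= T -> exists y : L2 mu,
    is_bochner_integral `]0, t[ (fun s => S (t - s) (B (u s))) y /\
    z t = S t z0 + y %[ae mu].

Definition approximately_controllable : Prop :=
  forall (z0 z1 : L2 mu) (e : R), 0 < e ->
  exists (u : control) (z : R -> L2 mu),
    mild_solution u z0 z /\ L2norm mu (z T - z1) <= e.

End control.

Section smooth.
Context (R : realType) (n : nat).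

Definition partial (i : 'I_n) (f : 'rV[R]_n -> R) : 'rV[R]_n -> R :=
  'D_(delta_mx 0 i) f.

Definition iter_partial (s : seq 'I_n) (f : 'rV[R]_n -> R) : 'rV[R]_n -> R :=
  foldr partial f s.

Definition smooth (f : 'rV[R]_n -> R) : Prop :=
  forall s : seq 'I_n, continuous (iter_partial s f) /\
    forall i x, derivable (iter_partial s f) x (delta_mx 0 i).

Definition test_function (Omega : set 'rV[R]_n) (f : 'rV[R]_n -> R) : Prop :=
  [/\ smooth f, compact (closure [set x | f x != 0])
    & closure [set x | f x != 0] `<=` Omega].

End smooth.

(* Near each boundary point Omega is, up to a permutation of the coordinates
   and the choice of a side, the region above the graph of a smooth function
   of the other n - 1 coordinates. *)
Definition smooth_boundary (R : realType) (n : nat) (Omega : set 'rV[R]_n) :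
    Prop :=
  forall x0 : 'rV[R]_n, (closure Omega `\` interior Omega) x0 ->
  exists (i : 'I_n) (b : bool) (g : 'rV[R]_n.-1 -> R), smooth g /\
    \forall x \near x0, Omega x <-> 0 < (-1) ^+ b * (x 0 i - g (col' i x)).

Record smooth_domain (R : realType) (n : nat) := SmoothDomain {
  domain :> set 'rV[R]_n;
  domain_open : open domain;
  domain_connected : connected domain;
  domain_nonempty : domain !=set0;
  domain_bounded : bounded_set domain;
  domain_smooth_boundary : smooth_boundary domain
}.
Arguments domain_open {R n} s.

Section dirichlet_laplacian.
Context (R : realType) (n : nat) (Omega : smooth_domain R n).

Definition lebesgue_on : {measure set 'rV[R]_n -> \bar R} :=
  mrestr (lebesgue_rV R n) (open_measurable_rV (domain_open Omega)).

Local Notation H := (L2 lebesgue_on).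

Definition weak_partial (i : 'I_n) (f v : H) : Prop :=
  forall p, test_function Omega p ->
    \int[lebesgue_on]_x (f x * partial i p x) =
    - \int[lebesgue_on]_x (v x * p x).

Definition H1 (f : H) : Prop := forall i, exists v, weak_partial i f v.

Definition H2 (f : H) : Prop := forall i, exists v, weak_partial i f v /\ H1 v.

(* The closure of the test functions for the H^1 norm. *)
Definition H10 (f : H) : Prop :=
  H1 f /\ forall e : R, 0 < e -> exists p, [/\ test_function Omega p,
    L2norm lebesgue_on (fun x => f x - p x) <= e
  & forall i v, weak_partial i f v ->
      L2norm lebesgue_on (fun x => v x - partial i p x) <= e].

Definition dirichlet_laplacian (f g : H) : Prop :=
  [/\ H10 f, H2 f & exists v w : 'I_n -> H,
    (forall i, weak_partial i f (v i) /\ weak_partial i (v i) (w i)) /\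
    g = \sum_i w i %[ae lebesgue_on]].

Lemma indic_Lfun2 (omega : set 'rV[R]_n) : open omega -> omega `<=` Omega ->
  \1_omega \in Lfun lebesgue_on 2%:E.
Proof.
move=> oo sub; have mo := open_measurable_rV oo.
have mOmega := open_measurable_rV (domain_open Omega).
rewrite inE; apply/andP; split; rewrite inE/=; first exact: measurable_indic.
rewrite /finite_norm unlock poweR_lty//.
rewrite (_ : (fun _ => _) = EFin \o \1_omega); last first.
  apply/funext => x /=; rewrite indicE; congr EFin.
  by case: (x \in omega); rewrite ?normr1 ?powR1// normr0 powR0.
rewrite integral_indic// setIT.
apply: le_lt_trans (lebesgue_rV_bounded _ (@domain_bounded _ _ Omega)).
  change (lebesgue_rV R n (omega `&` Omega) <= lebesgue_rV R n Omega)%E.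
  by rewrite setIidl//; apply: le_measure => //; exact/mem_set.
exact: mOmega.
Qed.

Definition L2_indic (omega : set 'rV[R]_n) (oo : open omega)
    (sub : omega `<=` Omega) : H :=
  Lfun_Sub (@lee1n R 2) (indic_Lfun2 oo sub).

(* The control operator lambda |-> lambda 1_omega. *)
Definition lumped_control (omega : set 'rV[R]_n) (oo : open omega)
    (sub : omega `<=` Omega) (lambda : R) : H :=
  lambda *: L2_indic oo sub.

End dirichlet_laplacian.
Arguments dirichlet_laplacian {R n} Omega f g.

(* Main.v *)
Require Import Defs.
From HB Require Import structures.
From mathcomp Require Import all_boot all_order all_algebra.
From mathcomp Require Import all_classical all_reals all_analysis.
From mathcomp Require Import measurable_realfun.
From mathcomp Require Import ring lra zify.

(* By simplicity of the eigenvalues each S(t) acts on phi_j as a scalar, which is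
   multiplicative in t with derivative mu_j at 0, hence equals exp(mu_j t). The
   phi_j-coordinate of the state thus obeys a scalar equation driven by b_j u, with
   b_j the integral of phi_j over omega: if b_j = 0 it cannot be controlled.
   Conversely, controls concentrated near time T - t steer 0 close to multiples of
   S(t) 1_omega, 0 < t < T, so it is enough that the span of these states is dense.
   In coordinates this is a statement on sums of exponentials exp(t v), bounded on
   a half-line v <= 0: their uniform limits contain exp(t v) for every t > 0, not
   only t < T (truncated binomial expansions), hence all powers of a function h
   with h(v_j) = 1 and |h| < 1 elsewhere; these powers converge to the projection
   on phi_j. *)

Set Implicit Arguments.
Unset Strict Implicit.
Unset Printing Implicit Defensive.
Import Order.TTheory GRing.Theory Num.Theory.
Import numFieldNormedType.Exports.

Local Open Scope classical_set_scope.
Local Open Scope ring_scope.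

(** * Uniform limits of sums of exponentials *)

(** Simplicity is used twice: it makes [S t (phi j)] a multiple of [phi j], and it makes the [mu j]
    distinct, so that a function of the eigenvalue can single out one mode. An upper bound [M] of
    the eigenvalues is read off the boundedness of [S 1]; the half-line variable is therefore
    [v = mu j - M], and weights [expR (- (t * M))] undo the shift. On [v <= 0] a nonzero constant is
    no uniform limit of exponentials of positive rates, so [h] has to be a polynomial without
    constant term in one exponential. Its high powers involve rates far beyond [T]; the truncated
    expansions, whose error does not depend on the number of factors, do here what analytic
    continuation in [t] does in a duality argument. Two constraints shape the rest. Elements of [L2]
    are functions and [S t] is linear only almost everywhere, so identities are stated after pairing
    with an arbitrary vector, in a semi-inner product space. And a mild solution must be exhibited
    with its Bochner integral at every time: controls are step functions, and the integral comes
    from completeness. *)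

Section exponential_sums.
Context (R : realType).
Implicit Types (a t : R) (f g : R -> R) (s : seq (R * R)).

(** After multiplication by [k!] both sides are products of [k] factors: each factor [m - i],
    doubled, is at most [p], while those of the falling factorial of [p + k] exceed [p]. *)
Lemma bin_pow2_le m p k : (m.*2 <= p)%N -> ('C(m, k) * 2 ^ k <= 'C(p + k, k))%N.
Proof.
move=> mp; rewrite -(leq_pmul2r (fact_gt0 k)) mulnAC !bin_ffact.
elim: k => [|k IH] in m p mp *; first by rewrite !ffactn0.
case: m mp => [|m] mp; first by rewrite ffact0n.
case: p mp => // p; rewrite doubleS ltnS => mp.
rewrite ffactSS addSn ffactSS expnS.
have -> : (m.+1 * m ^_ k * (2 * 2 ^ k) = m.+1.*2 * (m ^_ k * 2 ^ k))%N.
  by rewrite -mul2n; lia.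
apply: leq_mul; first by rewrite -addnS; lia.
rewrite addnS -addSn; apply: IH; lia.
Qed.

(** The left-hand side is one of the nonnegative terms in the expansion of
    [(y + (1 - y)) ^+ (p + k) = 1]. *)
Lemma binomial_term_le1 (y : R) p k : 0 <= y <= 1 ->
  (1 - y) ^+ k * y ^+ p * 'C(p + k, k)%:R <= 1.
Proof.
move=> /andP[y0 y1].
have kpk : (k < (p + k).+1)%N by rewrite ltnS leq_addl.
rewrite [leRHS](_ : 1 = (y + (1 - y)) ^+ (p + k)); last by rewrite subrKC expr1n.
rewrite (exprDn y) (bigD1 (Ordinal kpk))//= addnK mulr_natr [_ * y ^+ p]mulrC.
rewrite lerDl sumr_ge0// => i _; rewrite mulrn_wge0// mulr_ge0// exprn_ge0//.
by rewrite subr_ge0.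
Qed.

(** Expand [(1 + (y - 1)) ^+ m]. By the two previous lemmas the term of rank [k] is at most
    ['C(m, k) / 'C(p + k, k) <= 2 ^- k], so the tail is bounded independently of [y], [m] and
    [p]. *)
Lemma truncated_binomial (y : R) m p K : 0 <= y <= 1 -> (m.*2 <= p)%N ->
  `|y ^+ (p + m) - \sum_(k < K) 'C(m, k)%:R * ((y - 1) ^+ k * y ^+ p)| <=
  2 / 2 ^+ K.
Proof.
move=> y01 mp.
(* Padding with vanishing binomial coefficients allows the split at [K] even when [K] exceeds
   [m]. *)
have -> : y ^+ (p + m) =
    \sum_(k < K + m.+1) 'C(m, k)%:R * ((y - 1) ^+ k * y ^+ p).
  have -> : y ^+ (p + m) =
      \sum_(k < m.+1) 'C(m, k)%:R * ((y - 1) ^+ k * y ^+ p).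
    rewrite exprD mulrC -{1}(subrKC 1 y) exprDn mulr_suml.
    by apply: eq_bigr => i _; rewrite expr1n mul1r mulr_natl -mulrnAl.
  rewrite addnC big_split_ord/= [X in _ = _ + X]big1 ?addr0// => i _.
  by rewrite bin_small ?mul0r// leq_addr.
rewrite big_split_ord/= addrAC subrr add0r.
apply: (le_trans (ler_norm_sum _ _ _)).
apply: (@le_trans _ _ (\sum_(i < m.+1) (2^-1) ^+ (K + i))).
  apply: ler_sum => i _; rewrite !normrM normr_nat.
  have /andP[y0 y1] := y01.
  rewrite normrX (ler0_norm (_ : y - 1 <= 0)) ?subr_le0// opprB.
  rewrite ger0_norm ?exprn_ge0//.
  set k := (K + i)%N; rewrite exprVn -(div1r (2 ^+ k)) ler_pdivlMr ?exprn_gt0//.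
    apply: le_trans (binomial_term_le1 p k y01).
  rewrite mulrAC mulrC ler_wpM2l//.
    by rewrite mulr_ge0// exprn_ge0// subr_ge0.
  by rewrite -natrX -natrM ler_nat bin_pow2_le.
under eq_bigr do rewrite exprD.
rewrite -mulr_sumr exprVn [2 / _]mulrC ler_pM2l ?invr_gt0 ?exprn_gt0//.
have -> : \sum_(i < m.+1) 2^-1 ^+ i = 2 - 2 * 2^-1 ^+ m.+1 :> R.
  elim: m.+1 => [|n IH]; first by rewrite big_ord0 expr0; lra.
  by rewrite big_ord_recr/= IH exprS; field.
by rewrite gerBl mulr_ge0// exprn_ge0.
Qed.

Definition expsum s (v : R) : R := \sum_(p <- s) p.1 * expR (p.2 * v).

(** Rates are confined to []0, T[] because they become the times [tau] of the states [S tau b]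
    reachable before [T]. *)
Definition expsum_limit (T : R) f := forall e : R, 0 < e -> exists s,
  (forall p, p \in s -> 0 < p.2 < T) /\ forall v, v <= 0 -> `|f v - expsum s v| <= e.

Lemma expsum_limit_exp T t : 0 < t < T -> expsum_limit T (fun v => expR (t * v)).
Proof.
move=> tT e e0; exists [:: (1, t)]; split; first by move=> p /[!inE] /eqP ->.
by move=> v _; rewrite /expsum big_seq1 mul1r subrr normr0 ltW.
Qed.

Lemma expsum_limit0 T : expsum_limit T (fun=> 0).
Proof.
move=> e e0; exists [::]; split=> // v _.
by rewrite /expsum big_nil subrr normr0 ltW.
Qed.

Lemma expsum_limit_closed T f :
  (forall e, 0 < e -> exists2 g, expsum_limit T g &
    forall v, v <= 0 -> `|f v - g v| <= e) -> expsum_limit T f.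
Proof.
move=> fl e e0; have e20 : 0 < e / 2 by rewrite divr_gt0.
have [g /(_ _ e20)[s [sT gs]] fg] := fl _ e20.
exists s; split=> // v v0; rewrite (splitr e).
by apply: le_trans (ler_distD (g v) _ _) _; rewrite lerD ?fg ?gs.
Qed.

Lemma expsum_limitD T a f g : expsum_limit T f -> expsum_limit T g ->
  expsum_limit T (fun v => a * f v + g v).
Proof.
move=> fl gl e e0; have e20 : 0 < e / 2 by rewrite divr_gt0.
have a0 : 0 < `|a| + 1 by rewrite ltr_wpDl.
have [s [sT fs]] := fl _ (divr_gt0 e20 a0).
have [s' [s'T gs]] := gl _ e20.
exists ([seq (a * p.1, p.2) | p <- s] ++ s'); split.
  by move=> p; rewrite mem_cat => /orP[/mapP[q /sT qT ->]|/s'T].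
move=> v v0; rewrite /expsum big_cat big_map/=.
under eq_bigr do rewrite -mulrA.
rewrite -mulr_sumr opprD addrACA -mulrBr (splitr e).
apply: le_trans (ler_normD _ _) _; rewrite lerD ?gs// normrM.
apply: (@le_trans _ _ ((`|a| + 1) * (e / 2 / (`|a| + 1)))).
  by rewrite ler_pM ?lerDl ?fs.
by rewrite mulrC divfK// gt_eqF.
Qed.

Lemma expsum_limit_sum T n (c : 'I_n -> R) (f : 'I_n -> R -> R) :
  (forall i, expsum_limit T (f i)) ->
  expsum_limit T (fun v => \sum_(i < n) c i * f i v).
Proof.
elim: n c f => [|n IH] c f fl.
  by under eq_fun do rewrite big_ord0; exact: expsum_limit0.
under eq_fun do rewrite big_ord_recl.
exact/expsum_limitD/IH.
Qed.

(** With [y = expR (d * v)], the polynomial [(y - 1) ^+ k * y ^+ q] involves only the powers [q] to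
    [q + k] of [y]; [q] is positive to keep the rate 0 out. *)
Lemma expsum_limit_subr1X T d N :
  (forall q, (0 < q <= N)%N -> expsum_limit T (fun v => expR (d * v) ^+ q)) ->
  forall k q, (0 < q)%N -> (q + k <= N)%N ->
  expsum_limit T (fun v => (expR (d * v) - 1) ^+ k * expR (d * v) ^+ q).
Proof.
move=> Wd; elim=> [|k IH] q q0 qk.
  by under eq_fun do rewrite expr0 mul1r; apply: Wd; rewrite q0 -[q]addn0.
rewrite (_ : (fun _ => _) = fun v =>
    -1 * ((expR (d * v) - 1) ^+ k * expR (d * v) ^+ q) +
    (expR (d * v) - 1) ^+ k * expR (d * v) ^+ q.+1).
  by apply: expsum_limitD; apply: IH => //; lia.
by apply/funext => v; rewrite !exprS; ring.
Qed.

(* Binomial expansion of [y ^+ 3m] at [y = 1] around [y ^+ 2m], where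
   [y = expR (t v / 3m)]: after truncation only the rates close to [2t/3] remain. *)
Lemma expsum_limit_extend T a :
  (forall t, 0 < t < a -> expsum_limit T (fun v => expR (t * v))) ->
  forall t, 0 < t -> 2 * t < 3 * a -> expsum_limit T (fun v => expR (t * v)).
Proof.
move=> Wa t t0 ta; apply: expsum_limit_closed => e e0.
have [K Ke] : exists K, 2 / 2 ^+ K <= e.
  have e20 := divr_gt0 e0 (ltr0n R 2).
  have [K _ /(_ K (leqnn K))] := near_infty_natSinv_expn_lt (PosNum e20).
  rewrite /= div1r => Ke; exists K.
  by move: (ltW Ke); rewrite ler_pdivlMr// mulrC.
(* [K] is fixed first since the error ignores [m]. The largest rate used is [(2m + K) * t / 3m]; it
   is below [a] exactly under this condition, which [2 * t < 3 * a] makes satisfiable. *)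
have [m m0 mK] : exists2 m, (0 < m)%N & t * K%:R < m%:R * (3 * a - 2 * t).
  have d0 : 0 < 3 * a - 2 * t by rewrite subr_gt0.
  exists (Num.truncn (t * K%:R / (3 * a - 2 * t))).+1 => //.
  by rewrite -ltr_pdivrMr// truncnS_gt.
pose d := t / (3 * m%:R).
have m30 : 0 < 3 * m%:R :> R by rewrite mulr_gt0 ?ltr0n.
have d0 : 0 < d by rewrite divr_gt0.
have da q : (q <= m.*2 + K)%N -> q%:R * d < a.
  move=> qK; apply: (@le_lt_trans _ _ ((m.*2 + K)%:R * d)).
    by rewrite ler_wpM2r ?ler_nat ?ltW.
  rewrite /d mulrA ltr_pdivrMr// natrD -mul2n natrM; move: mK; lra.
exists (fun v => \sum_(k < K) 'C(m, k)%:R *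
  ((expR (d * v) - 1) ^+ k * expR (d * v) ^+ m.*2)).
  apply: expsum_limit_sum => i.
  apply: (@expsum_limit_subr1X _ _ (m.*2 + K)) => [q /andP[q0 qK]||].
  - under eq_fun do rewrite -expRM_natl mulrA.
    by apply: Wa; rewrite mulr_gt0 ?ltr0n//= da.
  - by rewrite double_gt0.
  - by rewrite leq_add2l ltnW.
move=> v v0; apply: le_trans Ke.
have -> : expR (t * v) = expR (d * v) ^+ (m.*2 + m).
  rewrite -expRM_natl; congr expR; rewrite mulrA /d -mul2n natrD natrM; field.
  by rewrite pnatr_eq0 -lt0n.
apply: truncated_binomial => //.
by rewrite expR_ge0 expR_le1 pmulr_rle0.
Qed.

Lemma expsum_limit_expT T t : 0 < T -> 0 < t ->
  expsum_limit T (fun v => expR (t * v)).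
Proof.
move=> T0 t0.
(* Each round extends the range of rates by [T / 2]: the available factor 3/2 suffices because
   [3 * (2 + n) / 2 >= 3 + n]. *)
suff H n : forall t, 0 < t -> 2 * t < (2 + n%:R) * T ->
    expsum_limit T (fun v => expR (t * v)).
  apply: (H (Num.truncn (2 * t / T)).+1) => //.
  apply: (@lt_le_trans _ _ ((Num.truncn (2 * t / T)).+1%:R * T)).
    by rewrite -ltr_pdivrMr// truncnS_gt.
  by rewrite ler_pM2r// lerDr.
elim: n => [|n IH] {}t {}t0 tT.
  by apply: expsum_limit_exp; rewrite t0; move: tT; lra.
apply: (@expsum_limit_extend _ ((2 + n%:R) / 2 * T)) => // [s /andP[s0 sT]|].
  by apply: IH => //; move: sT; lra.
have : 0 <= n%:R * T by rewrite mulr_ge0// ltW.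
by move: tT; rewrite -(natr1 n); lra.
Qed.

(** With [x = expR (d * v)], the parabola [1 - (1 - x / x0) ^+ 2] has its peak at [x0] and lies in
    [[0, 1]] as long as [x / x0] stays between 0 and 2. *)
Lemma expsum_limit_peak T v0 : 0 < T -> v0 <= 0 -> exists h : R -> R,
  [/\ forall n, expsum_limit T (fun v => h v ^+ n.+1), h v0 = 1,
      forall v, v <= 0 -> `|h v| <= 1
    & forall v, v <= 0 -> v != v0 -> `|h v| < 1].
Proof.
move=> T0 v00.
have d0 : 0 < 4 * (1 - v0) by lra.
(* This [d] gives [d * v0 > - 1 / 4], hence [x0 > 1 / 2], and [x <= 1 < 2 * x0] on the whole
   half-line. *)
pose d := (4 * (1 - v0))^-1; have dp : 0 < d by rewrite invr_gt0.
pose x0 := expR (d * v0); have x00 : 0 < x0 by exact: expR_gt0.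
have x0h : 1 / 2 < x0.
  apply: lt_le_trans (expR_ge1Dx _).
  have : d * (4 * (1 - v0)) = 1 by rewrite mulVf// gt_eqF.
  by move: dp; lra.
have xx v : v <= 0 -> 0 < expR (d * v) / x0 < 2.
  move=> v0'; rewrite divr_gt0 ?expR_gt0//= ltr_pdivrMr//.
  by apply: (@le_lt_trans _ _ 1); [rewrite expR_le1 pmulr_rle0|lra].
pose h v := 1 - (1 - expR (d * v) / x0) ^+ 2.
have h01 v : v <= 0 -> 0 <= h v <= 1.
  move=> /xx; set x := _ / x0 => /andP[x1 x2].
  rewrite /h -/x gerBl sqr_ge0 andbT.
  have : 0 < x * (2 - x) by rewrite mulr_gt0// subr_gt0.
  by rewrite expr2; lra.
exists h; split.
(* As [h = 2 x / x0 - (x / x0) ^+ 2], multiplying by [h] raises the power of [x]; the extra factor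
   [x ^+ q.+1] keeps every rate positive down to [n = 0]. *)
- suff W n q : expsum_limit T (fun v => expR (d * v) ^+ q.+1 * h v ^+ n).
    move=> n; rewrite (_ : (fun _ => _) = fun v =>
      - x0^-1 ^+ 2 * (expR (d * v) ^+ 2 * h v ^+ n) +
      (2 / x0 * (expR (d * v) ^+ 1 * h v ^+ n) + 0)).
      by do 2!apply: expsum_limitD => //; exact: expsum_limit0.
    by apply/funext => v; rewrite exprSr {2}/h; field; rewrite gt_eqF.
  elim: n q => [|n IH] q.
    under eq_fun do rewrite expr0 mulr1 -expRM_natl mulrA.
    by apply: expsum_limit_expT => //; rewrite mulr_gt0.
  rewrite (_ : (fun _ => _) = fun v =>
    - x0^-1 ^+ 2 * (expR (d * v) ^+ q.+3 * h v ^+ n) +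
    (2 / x0 * (expR (d * v) ^+ q.+2 * h v ^+ n) + 0)).
    by do 2!apply: expsum_limitD => //; exact: expsum_limit0.
  by apply/funext => v; rewrite (exprSr (h v)) {2}/h !exprS; field; rewrite gt_eqF.
- by rewrite /h divff ?gt_eqF// subrr expr0n/= subr0.
- by move=> v /h01/andP[? ?]; rewrite ger0_norm.
- move=> v v0' vv0; have /andP[? ?] := h01 _ v0'.
  rewrite ger0_norm// /h ltrBlDr ltrDl exprn_even_gt0//= subr_eq0.
  apply: contra vv0; rewrite eq_sym => /eqP xx0.
  have /expR_inj/mulfI -> // : expR (d * v) = expR (d * v0).
    by rewrite -/x0 -[RHS]mul1r -xx0 divfK// gt_eqF.
  by rewrite gt_eqF.
Qed.
End exponential_sums.

(** * Semi-inner product spaces *)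

(** Definiteness is left out on purpose: a function that vanishes almost everywhere has norm 0
    without being 0 in [L2 mu]. *)
Record semi_inner (R : realType) (V : lmodType R) := SemiInner {
  inner :> V -> V -> R;
  innerC : forall f g, inner f g = inner g f;
  innerP : forall a f g h, inner (a *: f + g) h = a * inner f h + inner g h;
  inner_ge0 : forall f, 0 <= inner f f
}.

Section semi_inner_theory.
Context (R : realType) (V : lmodType R) (dot : semi_inner V).
Implicit Types (f g h : V) (a : R).

Definition snorm f := Num.sqrt (dot f f).

Lemma inner0l f : dot 0 f = 0.
Proof. by have := innerP dot (-1) f f f; rewrite scaleN1r addNr mulN1r addNr. Qed.

Lemma innerDl f g h : dot (f + g) h = dot f h + dot g h.
Proof. by have := innerP dot 1 f g h; rewrite scale1r mul1r. Qed.

Lemma innerZl a f h : dot (a *: f) h = a * dot f h.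
Proof. by have := innerP dot a f 0 h; rewrite addr0 inner0l addr0. Qed.

Lemma innerNl f h : dot (- f) h = - dot f h.
Proof. by rewrite -scaleN1r innerZl mulN1r. Qed.

Lemma innerBl f g h : dot (f - g) h = dot f h - dot g h.
Proof. by rewrite innerDl innerNl. Qed.

Lemma inner_suml (I : Type) (r : seq I) (P : pred I) (F : I -> V) h :
  dot (\sum_(i <- r | P i) F i) h = \sum_(i <- r | P i) dot (F i) h.
Proof.
exact: (big_morph (fun f => dot f h) (fun f g => innerDl f g h) (inner0l h)).
Qed.

Lemma innerDr f g h : dot h (f + g) = dot h f + dot h g.
Proof. by rewrite innerC innerDl ![dot _ h]innerC. Qed.

Lemma innerZr a f h : dot h (a *: f) = a * dot h f.
Proof. by rewrite innerC innerZl innerC. Qed.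

Lemma innerBr f g h : dot h (f - g) = dot h f - dot h g.
Proof. by rewrite innerC innerBl ![dot _ h]innerC. Qed.

Lemma snorm_ge0 f : 0 <= snorm f. Proof. exact: sqrtr_ge0. Qed.

Lemma snorm_sqr f : snorm f ^+ 2 = dot f f.
Proof. by rewrite sqr_sqrtr// inner_ge0. Qed.

Lemma snorm0 : snorm 0 = 0. Proof. by rewrite /snorm inner0l sqrtr0. Qed.

Lemma snormZ a f : snorm (a *: f) = `|a| * snorm f.
Proof.
by rewrite /snorm innerZl innerZr mulrA -expr2 sqrtrM ?sqr_ge0// sqrtr_sqr.
Qed.

Lemma snormN f : snorm (- f) = snorm f.
Proof. by rewrite -scaleN1r snormZ normrN1 mul1r. Qed.

Lemma snorm_distC f g : snorm (f - g) = snorm (g - f).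
Proof. by rewrite -snormN opprB. Qed.

Lemma cauchy_schwarz f g : `|dot f g| <= snorm f * snorm g.
Proof.
rewrite -[leRHS]ger0_norm ?mulr_ge0 ?snorm_ge0// -ler_sqr ?nnegrE//.
rewrite !real_normK ?num_real// exprMn !snorm_sqr.
have q t : 0 <= dot f f - 2 * t * dot f g + t ^+ 2 * dot g g.
  have := inner_ge0 dot (f - t *: g).
  rewrite innerBl !innerBr innerZl !innerZr !innerZl [dot g f]innerC; lra.
have [g0|g0] := eqVneq (dot g g) 0.
  rewrite g0 mulr0; have [->|fg0] := eqVneq (dot f g) 0; first by rewrite expr0n.
  (* For [dot g g = 0] the expression in [q] is affine in [t], and it equals -1 at this [t]. *)
  have := q ((dot f f + 1) / (2 * dot f g)); rewrite g0 mulr0 addr0.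
  by rewrite (_ : 2 * _ * _ = dot f f + 1); [lra|field].
have g1 : 0 < dot g g by rewrite lt_def g0 inner_ge0.
have := q (dot f g / dot g g); rewrite -(pmulr_lge0 _ g1).
by rewrite [X in 0 <= X](_ : _ = dot f f * dot g g - dot f g ^+ 2)
  ?subr_ge0//; field.
Qed.

Lemma snormD f g : snorm (f + g) <= snorm f + snorm g.
Proof.
rewrite -ler_sqr ?nnegrE ?addr_ge0 ?snorm_ge0// snorm_sqr sqrrD !snorm_sqr.
rewrite innerDl !innerDr [dot g f]innerC.
by have := le_trans (ler_norm _) (cauchy_schwarz f g); lra.
Qed.

Lemma snormB f g : snorm (f - g) <= snorm f + snorm g.
Proof. by rewrite -(snormN g) snormD. Qed.

Lemma snorm_distD h f g : snorm (f - g) <= snorm (f - h) + snorm (h - g).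
Proof. by apply: le_trans (snormD _ _); rewrite addrA subrK. Qed.

Lemma snorm_sum (I : Type) (r : seq I) (F : I -> V) :
  snorm (\sum_(i <- r) F i) <= \sum_(i <- r) snorm (F i).
Proof.
elim: r => [|i r IH]; first by rewrite !big_nil snorm0.
by rewrite !big_cons (le_trans (snormD _ _))// lerD2l.
Qed.

Lemma snorm_eq_dist0 f g : snorm (f - g) = 0 -> snorm f = snorm g.
Proof.
move=> fg0; apply/eqP; rewrite eq_le.
have := snorm_distD g f 0; have := snorm_distD f g 0.
by rewrite !subr0 fg0 snorm_distC fg0 !add0r => -> ->.
Qed.

Lemma inner_dist0 f g h : snorm (f - g) = 0 -> dot f h = dot g h.
Proof.
move=> fg0; apply/eqP; rewrite -subr_eq0 -innerBl -normr_le0.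
by rewrite (le_trans (cauchy_schwarz _ _))// fg0 mul0r.
Qed.

(** * Fourier partial sums with respect to an orthonormal basis *)

Section orthonormal_basis.
Variable e : nat -> V.
Hypothesis orthonormal : forall i j, dot (e i) (e j) = (i == j)%:R.
Hypothesis total : forall f (eps : R), 0 < eps ->
  exists (N : nat) (c : 'I_N -> R), snorm (f - \sum_(j < N) c j *: e j) <= eps.

Definition partial_sum N f := \sum_(j < N) dot f (e j) *: e j.

Lemma snorm_basis j : snorm (e j) = 1.
Proof. by rewrite /snorm orthonormal eqxx sqrtr1. Qed.

Lemma inner_combination N (c : 'I_N -> R) (j : 'I_N) :
  dot (\sum_(i < N) c i *: e i) (e j) = c j.
Proof.
rewrite inner_suml (bigD1 j)//= innerZl orthonormal eqxx mulr1 big1 ?addr0//.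
by move=> i ij; rewrite innerZl orthonormal (inj_eq val_inj) (negbTE ij) mulr0.
Qed.

Lemma inner_partial_sum N f j :
  dot (partial_sum N f) (e j) = if (j < N)%N then dot f (e j) else 0.
Proof.
case: ifPn => [jN|]; first exact: (inner_combination _ (Ordinal jN)).
rewrite -leqNgt => Nj; rewrite inner_suml big1// => i _.
by rewrite innerZl orthonormal ltn_eqF ?mulr0// (leq_trans _ Nj).
Qed.

Lemma snorm_combination_sqr N (c : 'I_N -> R) :
  snorm (\sum_(j < N) c j *: e j) ^+ 2 = \sum_(j < N) c j ^+ 2.
Proof.
rewrite snorm_sqr inner_suml; apply: eq_bigr => i _.
by rewrite innerZl innerC inner_combination expr2.
Qed.

(** The remainder [f - partial_sum N f] is orthogonal to the span of the first [N] vectors. This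
    yields both the best approximation property and, for [c = 0], the splitting of the norm of
    [f]. *)
Lemma pythagoras N f (c : 'I_N -> R) :
  snorm (f - \sum_(j < N) c j *: e j) ^+ 2 =
  snorm (f - partial_sum N f) ^+ 2 + \sum_(j < N) (dot f (e j) - c j) ^+ 2.
Proof.
set p := partial_sum N f; set q := \sum_(j < N) _.
have -> : \sum_(j < N) (dot f (e j) - c j) ^+ 2 = snorm (p - q) ^+ 2.
  rewrite -snorm_combination_sqr /p /q /partial_sum -sumrB.
  by congr (snorm _ ^+ 2); apply: eq_bigr => i _; rewrite scalerBl.
have pq0 : dot (f - p) (p - q) = 0.
  rewrite /p /q /partial_sum -sumrB innerC inner_suml big1// => i _.
  by rewrite -scalerBl innerZl [X in _ * X]innerC innerBl inner_combination
    subrr mulr0.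
have {1}-> : f - q = (f - p) + (p - q) by rewrite addrA subrK.
move: (f - p) (p - q) pq0 => x y xy0.
by rewrite !snorm_sqr innerDl !innerDr [dot y x]innerC xy0 addr0 add0r.
Qed.

Lemma snorm_sqr_partial_sum N f : snorm f ^+ 2 =
  snorm (f - partial_sum N f) ^+ 2 + \sum_(j < N) dot f (e j) ^+ 2.
Proof.
have := pythagoras f (fun _ : 'I_N => 0).
rewrite [X in f - X]big1 ?subr0//; last by move=> i _ /=; rewrite scale0r.
by move=> ->; congr (_ + _); apply: eq_bigr => i _; rewrite subr0.
Qed.

Lemma partial_sum_approx f (eps : R) : 0 < eps ->
  exists N, snorm (f - partial_sum N f) <= eps.
Proof.
move=> e0; have [N [c fc]] := total f e0; exists N; apply: le_trans fc.
rewrite -ler_sqr ?nnegrE ?snorm_ge0// [leRHS]pythagoras lerDl.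
by apply: sumr_ge0 => i _; exact: sqr_ge0.
Qed.

(** Coordinatewise domination carries over to norms: compare finite sums of squares, and let the
    remainder of [f] tend to 0. This serves in place of an infinite Parseval identity. *)
Lemma le_snorm_basis K f g : 0 <= K ->
  (forall j, `|dot f (e j)| <= K * `|dot g (e j)|) -> snorm f <= K * snorm g.
Proof.
move=> K0 fg.
rewrite -ler_sqr ?nnegrE ?mulr_ge0 ?snorm_ge0//.
apply/ler_addgt0Pr => eps eps0.
have e0 : 0 < Num.sqrt eps by rewrite sqrtr_gt0.
have [N fN] := partial_sum_approx f e0.
rewrite (snorm_sqr_partial_sum N f) addrC lerD//; last first.
  by rewrite -[leRHS]sqr_sqrtr ?ler_sqr ?nnegrE ?snorm_ge0 ?sqrtr_ge0// ltW.
rewrite exprMn (snorm_sqr_partial_sum N g).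
apply: (@le_trans _ _ (K ^+ 2 * \sum_(j < N) dot g (e j) ^+ 2)).
  rewrite mulr_sumr; apply: ler_sum => j _.
  rewrite -exprMn -[leLHS]real_normK ?num_real// -[leRHS]real_normK ?num_real//.
  by rewrite ler_sqr ?nnegrE// normrM (ger0_norm K0).
by rewrite ler_wpM2l ?sqr_ge0// lerDr sqr_ge0.
Qed.

(** * Density of the span of an orbit of a diagonal semigroup *)

Section diagonal_semigroup.
Variables (mu : nat -> R) (M : R) (b : V) (D : R -> V).
Hypothesis mu_inj : injective mu.
Hypothesis muM : forall j, mu j <= M.
Hypothesis b_neq0 : forall j, dot b (e j) != 0.
Hypothesis orbitE : forall (t : R) j, 0 <= t ->
  dot (D t) (e j) = expR (mu j * t) * dot b (e j).

Definition orbit_comb (s : seq (R * R)) := \sum_(p <- s) p.1 *: D p.2.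

Definition orbit_limit (T : R) w := forall eps : R, 0 < eps -> exists s,
  (forall p, p \in s -> 0 < p.2 < T) /\ snorm (w - orbit_comb s) <= eps.

(** A combination of states acts on the coordinates of [b] as an exponential sum, taken here close
    to [h ^+ n.+1]. Among the first [I] indices only [j] survives for large [n]; beyond them the
    multiplier is merely bounded, and the tail of [b] is small. *)
Lemma orbit_limit_basis (T : R) j : 0 < T -> orbit_limit T (dot b (e j) *: e j).
Proof.
move=> T0 eps eps0.
pose v i := mu i - M; have v0 i : v i <= 0 by rewrite subr_le0.
have [h [hT hj h1 h2]] := expsum_limit_peak T0 (v0 j).
(* The first [I] coordinates will contribute at most [2 * d * snorm b] and the others at most
   [3 * d]. *)
pose C := 3 + 2 * snorm b; have C0 : 0 < C.
  by rewrite ltr_pwDl// mulr_ge0// snorm_ge0.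
pose d := Num.min (eps / C) 1; have d0 : 0 < d by rewrite lt_min divr_gt0//= ltr01.
have [I bI] := partial_sum_approx b d0.
have [n hn] : exists n, forall i, (i < I)%N -> i != j -> `|h (v i)| ^+ n.+1 <= d.
  elim: I {bI} => [|I [n IH]]; first by exists 0%N.
  have [m hm] : exists m, I != j -> `|h (v I)| ^+ m.+1 <= d.
    have [->|Ij] := eqVneq I j; first by exists 0%N.
    have hI : `|h (v I)| < 1.
      by apply: h2 => //; rewrite (inj_eq (addIr _)) (inj_eq mu_inj).
    have := @cvg_expr R `|h (v I)|; rewrite normr_id => /(_ hI)/cvgrPdist_le.
    move=> /(_ _ d0)[m _ /(_ m.+1 (leqnSn m))]; rewrite sub0r normrN.
    by rewrite ger0_norm ?exprn_ge0// => ?; exists m.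
  exists (maxn n m) => i; rewrite ltnS leq_eqVlt => /predU1P[->|iI] ij.
    apply: le_trans (hm ij); apply: ler_wiXn2l => //; first exact: h1.
    by rewrite ltnS leq_maxr.
  apply: le_trans (IH i iI ij); apply: ler_wiXn2l => //; first exact: h1.
  by rewrite ltnS leq_maxl.
have [s [sT hs]] := hT n d d0.
(* The weight [expR (- (t * M))] turns the factor [expR (mu i * t)] of the orbit into
   [expR (t * v i)]. *)
exists [seq (p.1 * expR (- (p.2 * M)), p.2) | p <- s]; split.
  by move=> p /mapP[q /sT qT ->].
set w := orbit_comb _.
have wE i : dot w (e i) = expsum s (v i) * dot b (e i).
  rewrite /w /orbit_comb big_map inner_suml /expsum mulr_suml.
  rewrite big_seq [RHS]big_seq; apply: eq_bigr => p /sT /andP[p0 _].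
  rewrite innerZl orbitE ?ltW//= -!mulrA; congr (_ * _); rewrite mulrA -expRD.
  by congr (expR _ * _); rewrite /v; ring.
rewrite snorm_distC; set f := w - _.
have fE i : dot f (e i) = (expsum s (v i) - (i == j)%:R) * dot b (e i).
  rewrite innerBl wE innerZl orthonormal mulrBl eq_sym.
  by have [->|_] := eqVneq i j; rewrite ?(mulrC (dot b _)) ?mulr0 ?mul0r.
have d1 : d <= 1 by rewrite ge_min lexx orbT.
have f1 : snorm (partial_sum I f) <= 2 * d * snorm b.
  apply: le_snorm_basis => [|i]; first by rewrite mulr_ge0// ltW.
  rewrite inner_partial_sum; case: ifPn => [iI|_]; last first.
    by rewrite normr0 !mulr_ge0// ltW.
  rewrite fE normrM ler_wpM2r//.
  have := hs (v i) (v0 i); have [ij|ij] := eqVneq i j.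
    rewrite ij hj expr1n distrC => H; apply: (le_trans H).
    by rewrite ler_peMl ?ltW// ltr1n.
  have := hn i iI ij; rewrite -normrX; move: (h (v i) ^+ _) => x.
  rewrite subr0 distrC => xd sx; rewrite -[expsum _ _](subrK x).
  by rewrite (le_trans (ler_normD _ _))//; lra.
(* The factor 3 adds 1 for the power of [h], [d <= 1] for its approximation and 1 for the Kronecker
   symbol. *)
have f2 : snorm (f - partial_sum I f) <= 3 * snorm (b - partial_sum I b).
  apply: le_snorm_basis => // i; rewrite (innerBl f) (innerBl b) !inner_partial_sum.
  case: ifPn => _; first by rewrite !subrr normr0 mulr0.
  rewrite !subr0 fE normrM ler_wpM2r//.
  have := hs (v i) (v0 i); have := h1 _ (v0 i).
  move=> h1'; have : `|h (v i) ^+ n.+1| <= 1 by rewrite normrX exprn_ile1.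
  move: (h (v i) ^+ _) (expsum s _) => x y x1 xy.
  have -> : y - (i == j)%:R = x - (x - y) - (i == j)%:R by ring.
  apply: le_trans (ler_normB _ _) _; rewrite normr_nat.
  have := ler_normB x (x - y); case: (i == j) => /=; lra.
rewrite -[f](subrK (partial_sum I f)) (le_trans (snormD _ _))//.
apply: (@le_trans _ _ (d * C)).
  by move: f1 f2 bI; rewrite /C; lra.
by rewrite -ler_pdivlMr// ge_min lexx.
Qed.

Lemma orbit_limitD (T : R) a f g : orbit_limit T f -> orbit_limit T g ->
  orbit_limit T (a *: f + g).
Proof.
move=> fl gl eps e0; have e20 : 0 < eps / 2 by rewrite divr_gt0.
have a0 : 0 < `|a| + 1 by rewrite ltr_wpDl.
have [s [sT fs]] := fl _ (divr_gt0 e20 a0).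
have [s' [s'T gs]] := gl _ e20.
exists ([seq (a * p.1, p.2) | p <- s] ++ s'); split.
  by move=> p; rewrite mem_cat => /orP[/mapP[q /sT qT ->]|/s'T].
rewrite /orbit_comb big_cat big_map/=.
under eq_bigr do rewrite -scalerA.
rewrite -scaler_sumr opprD addrACA -scalerBr (splitr eps).
apply: le_trans (snormD _ _) _; rewrite lerD ?gs// snormZ.
apply: (@le_trans _ _ ((`|a| + 1) * (eps / 2 / (`|a| + 1)))).
  by rewrite ler_pM ?lerDl ?snorm_ge0.
by rewrite mulrC divfK// gt_eqF.
Qed.

Theorem orbit_limit_all (T : R) w : 0 < T -> orbit_limit T w.
Proof.
move=> T0 eps e0; have e20 : 0 < eps / 2 by rewrite divr_gt0.
have [N wN] := partial_sum_approx w e20.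
suff H : orbit_limit T (partial_sum N w).
  have [s [sT ws]] := H _ e20; exists s; split=> //.
  by rewrite (splitr eps) (le_trans (snorm_distD (partial_sum N w) _ _))// lerD.
rewrite /partial_sum; elim: N {wN} => [|N IH].
  move=> d d0; exists [::]; split=> //.
  by rewrite /orbit_comb big_ord0 big_nil subrr snorm0 ltW.
rewrite big_ord_recr/= addrC.
(* Only here must the coordinates of [b] be nonzero: the [N]-th term of the sum is rewritten as a
   multiple of [dot b (e N) *: e N]. *)
rewrite -[dot w _](divfK (b_neq0 N)) -scalerA.
exact/orbit_limitD/IH/orbit_limit_basis.
Qed.

End diagonal_semigroup.
End orthonormal_basis.
End semi_inner_theory.

(** * The space L2 *)

Section L2_theory.
Context d (T : measurableType d) (R : realType) (mu : {measure set T -> \bar R}).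
Implicit Types f g h : L2 mu.

Lemma measurable_L2 f : measurable_fun setT f.
Proof. by []. Qed.

Lemma integrable_L2dot f g : mu.-integrable setT (EFin \o (fun x => f x * g x)).
Proof.
apply/Lfun1_integrable.
by apply: Lfun2_mul_Lfun1; exact: LfunP.
Qed.

Let L2dotC f g : L2dot mu f g = L2dot mu g f.
Proof. by apply: eq_Rintegral => x _; rewrite mulrC. Qed.

Let L2dotP a f g h : L2dot mu (a *: f + g) h = a * L2dot mu f h + L2dot mu g h.
Proof.
rewrite /L2dot -RintegralZl ?integrable_L2dot// -RintegralD//.
- by apply: eq_Rintegral => x _; rewrite /= mulrDl mulrA.
- under eq_fun do rewrite /= mulrA.
  exact: (integrable_L2dot (a *: f) h).
- exact: integrable_L2dot.
Qed.

Let L2dot_ge0 f : 0 <= L2dot mu f f.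
Proof. by apply: Rintegral_ge0 => x _; rewrite -expr2 sqr_ge0. Qed.

Definition L2_inner : semi_inner (L2 mu) := SemiInner L2dotC L2dotP L2dot_ge0.

Lemma L2normE f : L2norm mu f = snorm L2_inner f.
Proof.
rewrite /L2norm /snorm unlock /= fine_poweR /Rintegral powR12_sqrt; last first.
  by rewrite fine_ge0// integral_ge0.
congr (Num.sqrt (fine _)); apply: eq_integral => x _.
by rewrite /= powR_mulrn// real_normK ?num_real// expr2.
Qed.

Lemma L2norm_sqr f : (\int[mu]_x (f x ^+ 2)%:E = (snorm L2_inner f ^+ 2)%:E)%E.
Proof.
rewrite snorm_sqr /= /L2dot /Rintegral fineK; last first.
  exact/integrable_fin_num/integrable_L2dot.
by apply: eq_integral => x _; rewrite expr2.
Qed.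

Lemma Lfun2P (f : T -> R) : measurable_fun setT f ->
  (\int[mu]_x (f x ^+ 2)%:E < +oo)%E -> f \in Lfun mu 2%:E.
Proof.
move=> mf foo; rewrite inE; apply/andP; split; rewrite inE//=.
rewrite /finite_norm unlock poweR_lty//.
under eq_integral do rewrite /= powR_mulrn// real_normK ?num_real//.
by [].
Qed.

Lemma snorm_ae f g : f = g %[ae mu] -> snorm L2_inner (f - g) = 0.
Proof.
move=> fg; rewrite /snorm; apply/eqP; rewrite sqrtr_eq0 /= /L2dot /Rintegral.
rewrite (ae_eq_integral (cst 0%E))//.
- by rewrite integral0.
- exact: (measurable_int mu (integrable_L2dot (f - g) (f - g))).
- apply: filterS fg => x /(_ I) fgx _.
  change (((f x - g x) * (f x - g x))%:E = 0%E :> \bar R).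
  by rewrite fgx subrr mulr0.
Qed.

(* The sum of the [4 ^+ k * (f k.+1 - f k) ^+ 2] has a finite integral, hence is
   finite almost everywhere, and there the increments decay geometrically. *)
Lemma cvg_ae_of_summable (f : nat -> L2 mu) C :
  (forall k, snorm L2_inner (f k.+1 - f k) <= C / 4 ^+ k) ->
  {ae mu, forall x, cvgn (f ^~ x)}.
Proof.
move=> fC; pose D k := f k.+1 - f k.
pose w k x : \bar R := (4 ^+ k * D k x ^+ 2)%:E.
have w0 k x : setT x -> (0 <= w k x)%E.
  by move=> _; rewrite lee_fin mulr_ge0 ?sqr_ge0 ?exprn_ge0//.
have mw k : measurable_fun setT (w k).
  apply/measurable_EFinP; apply: measurable_funM => //.
  exact: (measurable_funX _ (measurable_L2 (D k))).
have mW : measurable_fun setT (fun x => \sum_(0 <= k <oo) w k x)%E.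
  by apply: ge0_emeasurable_sum => // k x _ _; exact: w0.
have iW : mu.-integrable setT (fun x => \sum_(0 <= k <oo) w k x)%E.
  apply/integrableP; split => //.
  under eq_integral.
    move=> x _; rewrite gee0_abs; last by apply: nneseries_ge0 => k _ _; exact: w0.
    over.
  rewrite integral_nneseries//.
  apply: (@le_lt_trans _ _ (\sum_(0 <= k <oo)
      ((2 * C ^+ 2) / (2 ^ (k + 1))%:R)%:E)%E).
    apply: lee_nneseries => k _.
      by move=> _; apply: integral_ge0 => x; exact: w0.
    under eq_integral do rewrite /w EFinM.
    rewrite ge0_integralZl//; last 2 first.
    - apply/measurable_EFinP; exact: (measurable_funX _ (measurable_L2 (D k))).
    - by move=> x _; rewrite lee_fin sqr_ge0.
    rewrite L2norm_sqr -EFinM lee_fin.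
    apply: (@le_trans _ _ (4 ^+ k * (C / 4 ^+ k) ^+ 2)).
      rewrite ler_wpM2l ?exprn_ge0// ler_sqr ?nnegrE ?snorm_ge0 ?fC//.
      exact: le_trans (snorm_ge0 _ _) (fC k).
    have -> : 4 ^+ k * (C / 4 ^+ k) ^+ 2 = C ^+ 2 / 4 ^+ k.
      by field; rewrite expf_neq0.
    have -> : 2 * C ^+ 2 / (2 ^ (k + 1))%:R = C ^+ 2 / 2 ^+ k.
      by rewrite addn1 expnS natrM natrX; field; rewrite expf_neq0.
    rewrite ler_wpM2l ?sqr_ge0// lef_pV2 ?posrE ?exprn_gt0//.
    by apply: lerXn2r; rewrite ?nnegrE// ler_nat.
  rewrite (cvg_lim _ (@cvg_geometric_eseries_half R (2 * C ^+ 2) 0%N))//.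
  exact: ltry.
have := integrable_ae measurableT iW.
apply: filterS => x /(_ I) Wfin.
pose K := fine (\sum_(0 <= k <oo) w k x)%E.
have DK k : `|D k x| <= Num.sqrt K / 2 ^+ k.
  have wK : 4 ^+ k * D k x ^+ 2 <= K.
    rewrite -lee_fin /K fineK//.
    apply: le_trans (nneseries_lim_ge k.+1 _); last by move=> n _ _; exact: w0.
    rewrite big_nat_recr//= leeDr// sume_ge0// => i _; exact: w0.
  rewrite ler_pdivlMr ?exprn_gt0// -[leLHS]ger0_norm ?mulr_ge0 ?exprn_ge0//.
  rewrite -sqrtr_sqr ler_wsqrtr// (le_trans _ wK)//.
  rewrite exprMn real_normK ?num_real// mulrC -exprM mulnC exprM.
  by rewrite (_ : 2 ^+ 2 = 4)//; ring.
have : cvgn (series (telescope (f ^~ x))).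
  apply: normed_cvg => /=.
  apply: (@series_le_cvg _ _ (geometric (Num.sqrt K) 2^-1)) => //=.
  - by move=> n; rewrite exprVn; exact: DK.
  - by apply: is_cvg_geometric_series; rewrite ger0_norm// invf_lt1// ltr1n.
move=> cv; rewrite (_ : f ^~ x = (fun n => f 0%N x + series (telescope (f ^~ x)) n)).
  exact: is_cvgD (is_cvg_cst _) cv.
by apply/funext => n; rewrite -eq_sum_telescope.
Qed.

(** The sequence converges almost everywhere, and Fatou's lemma bounds the distance from [f n] to
    the limit. Taking [g] as an upper limit makes it measurable and defined at every point. *)
Lemma L2_complete (f : nat -> L2 mu) C :
  (forall k, snorm L2_inner (f k.+1 - f k) <= C / 4 ^+ k) ->
  exists g, forall n, snorm L2_inner (g - f n) <= 2 * C / 4 ^+ n.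
Proof.
move=> fC.
have C0 : 0 <= C.
  by have := le_trans (snorm_ge0 _ _) (fC 0%N); rewrite expr0 divr1.
have fnk n k : snorm L2_inner (f (n + k)%N - f n) <= 2 * C / 4 ^+ n.
  (* The factor [1 - 2^-1 ^+ k] strengthens the bound so that the induction on [k] closes. *)
  apply: (@le_trans _ _ (2 * C / 4 ^+ n * (1 - 2^-1 ^+ k))).
    elim: k => [|k IH]; first by rewrite addn0 subrr snorm0 expr0 subrr mulr0.
    apply: le_trans (snorm_distD _ (f (n + k)%N) _ _) _; rewrite addnS.
    apply: (le_trans (lerD (fC _) IH)).
    have pq : 4^-1 ^+ k <= 2^-1 ^+ k :> R.
      by rewrite lerXn2r ?nnegrE ?invr_ge0// lef_pV2 ?posrE// ler_nat.
    have Ca : 0 <= C * 4^-1 ^+ n by rewrite mulr_ge0// exprn_ge0// invr_ge0.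
    have := ler_wpM2l Ca pq.
    by rewrite exprD invfM -!exprVn (exprSr 2^-1); lra.
  rewrite ler_piMr ?gerBl ?exprn_ge0 ?invr_ge0// divr_ge0 ?mulr_ge0//.
have fcvg := cvg_ae_of_summable fC.
pose g x := fine (limn_esup (fun k => (f k x)%:E)).
have mg : measurable_fun setT g.
  apply: measurableT_comp => //; apply: measurable_fun_limn_esup => n.
  exact/measurable_EFinP.
have gE : {ae mu, forall x, f ^~ x @ \oo --> g x}.
  apply: filterS fcvg => x cv; rewrite /g.
  have /cvg_ex[l fl] := cv.
  have /cvg_limn_einf_sup[_ ->] // : (f n x)%:E @[n --> \oo] --> l%:E.
  by apply: cvg_EFin; [exact: nearW|].
have int_le n : (\int[mu]_x ((g x - f n x) ^+ 2)%:E <= ((2 * C / 4 ^+ n) ^+ 2)%:E)%E.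
  pose F k x : \bar R := ((f (n + k)%N x - f n x) ^+ 2)%:E.
  have mF k : measurable_fun setT (F k).
    apply/measurable_EFinP; apply: measurable_funX.
    exact: (measurable_L2 (f (n + k)%N - f n)).
  have F0 k x : setT x -> (0 <= F k x)%E by move=> _; rewrite lee_fin sqr_ge0.
  have Fle k : (\int[mu]_x F k x <= ((2 * C / 4 ^+ n) ^+ 2)%:E)%E.
    rewrite (L2norm_sqr (f (n + k)%N - f n)) lee_fin ler_sqr ?nnegrE ?snorm_ge0//.
    by rewrite divr_ge0 ?mulr_ge0// exprn_ge0.
  apply: (@le_trans _ _ (\int[mu]_x (limn_einf (F ^~ x)))%E).
    rewrite le_eqVlt; apply/orP; left; apply/eqP.
    apply: ae_eq_integral => //.
    - apply/measurable_EFinP; apply: measurable_funX; apply: measurable_funB => //.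
    - have -> : (fun x => limn_einf (F ^~ x)) =
          (fun x => - limn_esup (fun k => - F k x))%E.
        by apply/funext => x; rewrite (limn_esupN (F ^~ x)) oppeK.
      apply: measurableT_comp => //; apply: measurable_fun_limn_esup => k.
      exact: measurableT_comp.
    - apply: filterS gE => x fx _.
      have /cvg_limn_einf_sup[-> _] // :
          F k x @[k --> \oo] --> ((g x - f n x) ^+ 2)%:E.
      apply: cvg_EFin; [exact: nearW|].
      rewrite /F /comp /=.
      have : f (n + k)%N x @[k --> \oo] --> g x.
        move: fx; rewrite -(cvg_shiftn n) => fx.
        by under eq_fun do rewrite addnC; exact: fx.
      move=> h; under eq_fun do rewrite expr2.
      by rewrite expr2; apply: cvgM; apply: cvgB => //; exact: cvg_cst.
  apply: le_trans (fatou mu measurableT mF F0) _.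
  rewrite limn_einf_lim; apply: lime_le; first exact: is_cvg_einfs.
  apply: nearW => k; apply: le_trans (Fle k).
  by apply: ereal_inf_lbound; exists k => /=.
have gf0 : (fun x => g x - f 0%N x) \in Lfun mu 2%:E.
  apply: Lfun2P; first exact: measurable_funB.
  exact: le_lt_trans (int_le 0%N) (ltry _).
(* Square integrability is known for [g - f 0] only, by the bound at [n = 0]; adding [f 0] back
   gives the limit. *)
pose G : L2 mu := Lfun_Sub (@lee1n R 2) gf0 + f 0%N.
exists G => n; rewrite -ler_sqr ?nnegrE ?snorm_ge0//; last first.
  by rewrite divr_ge0 ?mulr_ge0// exprn_ge0.
rewrite -lee_fin -L2norm_sqr; apply: le_trans (int_le n).
rewrite le_eqVlt; apply/orP; left; apply/eqP; apply: eq_integral => x _.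
rewrite (_ : (G - f n) x = g x - f 0%N x + f 0%N x - f n x)//.
by rewrite subrK.
Qed.

End L2_theory.

(** * Bochner integrals *)

Section step_functions.
Context d (X : measurableType d) (R : realType) (lambda : {measure set X -> \bar R}).
Variable D : set X.
Hypothesis mD : measurable D.

Lemma integrable_scaled_indic (A : set X) (a : R) : measurable A ->
  (lambda (D `&` A) < +oo)%E -> lambda.-integrable D (fun x => (a * \1_A x)%:E).
Proof.
move=> mA fA; under eq_fun do rewrite EFinM; apply: integrableZl => //.
apply/integrableP; split.
  by apply/measurable_EFinP; exact: measurable_funTS.
under eq_integral do rewrite gee0_abs ?lee_fin//.
by rewrite integral_indic// setIC.
Qed.

Lemma Rintegral_scaled_indic (A : set X) (a : R) : measurable A ->
  (lambda (D `&` A) < +oo)%E ->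
  \int[lambda]_(x in D) (a * \1_A x) = a * fine (lambda (D `&` A)).
Proof.
move=> mA fA; rewrite RintegralZl//; last first.
  by have := integrable_scaled_indic 1 mA fA; under eq_fun do rewrite mul1r.
by rewrite /Rintegral integral_indic// setIC.
Qed.

Lemma step_integral n (A : 'I_n -> set X) (a : 'I_n -> R) :
  (forall i, measurable (A i)) -> (forall i, (lambda (D `&` A i) < +oo)%E) ->
  lambda.-integrable D (fun x => (\sum_i a i * \1_(A i) x)%:E) /\
  \int[lambda]_(x in D) (\sum_i a i * \1_(A i) x) =
  \sum_i a i * fine (lambda (D `&` A i)).
Proof.
elim: n A a => [|n IH] A a mA fA.
  split; first by under eq_fun do rewrite big_ord0; exact: integrable0.
  rewrite big_ord0; under eq_Rintegral do rewrite big_ord0.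
  by rewrite /Rintegral integral0.
have [iA IA] := IH _ (fun i => a (lift ord0 i)) (fun i => mA (lift ord0 i))
  (fun i => fA (lift ord0 i)).
have i0 := integrable_scaled_indic (a ord0) (mA ord0) (fA ord0).
split.
  under eq_fun do rewrite big_ord_recl EFinD.
  exact: integrableD.
rewrite big_ord_recl -IA -Rintegral_scaled_indic// -RintegralD//.
by apply: eq_Rintegral => x _; rewrite big_ord_recl.
Qed.
End step_functions.

Section bochner.
Context d (X : measurableType d) (R : realType) (mu : {measure set X -> \bar R}).
Local Notation H := (L2 mu).
Local Notation dot := (L2_inner mu).
Local Notation nrm := (snorm dot).
Local Notation sm_set s := (@sm_set _ _ _ _ _ s).
Local Notation sm_val s := (@sm_val _ _ _ _ _ s).
Local Notation sm_measurable s := (@sm_measurable _ _ _ _ _ s).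
Local Notation sm_finite s := (@sm_finite _ _ _ _ _ s).

(** The free translation [w] is what carries the induction over the terms: on [A] the new term is
    absorbed into [w]. *)
Lemma measurable_snorm_indic (A : set (measurableTypeR R)) (G : R -> H) (v : H) :
  measurable A -> (forall w, measurable_fun setT (fun x => nrm (G x + w))) ->
  forall w, measurable_fun setT (fun x => nrm (G x + \1_A x *: v + w)).
Proof.
move=> mA mG w.
rewrite (_ : (fun _ => _) =
    fun x => if x \in A then nrm (G x + (v + w)) else nrm (G x + w)).
  apply: measurable_fun_ifT => //; apply: (measurable_fun_bool true) => //.
  rewrite setTI (_ : _ @^-1` _ = A)//; apply/seteqP; split=> x /=.
    by move/set_mem.
  by move/mem_set.
apply/funext => x; rewrite indicE; case: ifP => _.
  by rewrite scale1r addrA.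
by rewrite scale0r addr0.
Qed.

Lemma measurable_snorm_step n (A : 'I_n -> set (measurableTypeR R)) (v : 'I_n -> H)
    (G : R -> H) : (forall i, measurable (A i)) ->
  (forall w, measurable_fun setT (fun x => nrm (G x + w))) ->
  forall w, measurable_fun setT
    (fun x => nrm (G x + \sum_i \1_(A i) x *: v i + w)).
Proof.
elim: n A v G => [|n IH] A v G mA mG w.
  under eq_fun do rewrite big_ord0 addr0; exact: mG.
rewrite (_ : (fun _ => _) = fun x => nrm (G x + \1_(A ord0) x *: v ord0 +
  \sum_i \1_(A (lift ord0 i)) x *: v (lift ord0 i) + w)); last first.
  by apply/funext => x; rewrite big_ord_recl addrA.
have := IH (fun i => A (lift ord0 i)) (fun i => v (lift ord0 i))
  (fun x => G x + \1_(A ord0) x *: v ord0).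
have m0 := @measurable_snorm_indic _ _ (v ord0) (mA ord0) mG.
by move=> /(_ (fun i => mA (lift ord0 i)) m0 w).
Qed.

Variable D : set (measurableTypeR R).
Hypothesis mD : measurable D.
Implicit Types s : simple_map mu D.

Lemma measurable_snorm_simple s s' :
  measurable_fun setT (fun x => nrm (sm_eval s x - sm_eval s' x)).
Proof.
have m0 w : measurable_fun setT (fun x : R => nrm ((0 : H) + w)).
  exact: measurable_cst.
have := @measurable_snorm_step _ _ (fun i => - sm_val s' i) _
  (sm_measurable s')
  (@measurable_snorm_step _ _ (sm_val s) _
    (sm_measurable s) m0) 0.
congr measurable_fun; apply/funext => x; rewrite add0r addr0 /sm_eval -sumrN.
by congr (snorm _ (_ + _)); apply: eq_bigr => i _; rewrite scalerN.
Qed.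

Lemma inner_sm_integral s (w : H) :
  lebesgue_measure.-integrable D (fun x => (dot (sm_eval s x) w)%:E) /\
  \int[lebesgue_measure]_(x in D) dot (sm_eval s x) w = dot (sm_integral s) w.
Proof.
have [iA IA] := step_integral mD (fun i => dot (sm_val s i) w)
  (sm_measurable s) (sm_finite s).
have E x : dot (sm_eval s x) w = \sum_i dot (sm_val s i) w * \1_(sm_set s i) x.
  by rewrite inner_suml; apply: eq_bigr => i _; rewrite innerZl mulrC.
split; first by under eq_fun do rewrite E.
under eq_Rintegral do rewrite E.
rewrite IA inner_suml; apply: eq_bigr => i _.
by rewrite innerZl mulrC.
Qed.

(* The difference [w] of the integrals is paired with itself, which only needs
   scalar integrals; the sets of a simple map may overlap. *)
Lemma snorm_sm_integralB s s' (h : R -> R) :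
  lebesgue_measure.-integrable D (EFin \o h) ->
  (forall x, D x -> nrm (sm_eval s x - sm_eval s' x) <= h x) ->
  nrm (sm_integral s - sm_integral s') <= \int[lebesgue_measure]_(x in D) h x.
Proof.
move=> ih sh; set w := sm_integral s - _.
have h0 x : D x -> 0 <= h x by move=> /sh; apply: le_trans; exact: snorm_ge0.
have [->|w0] := eqVneq (nrm w) 0; first exact: Rintegral_ge0.
have wp : 0 < nrm w by rewrite lt_def w0 snorm_ge0.
rewrite -(ler_pM2r wp) -expr2 snorm_sqr {1}/w innerBl.
have [i1 <-] := inner_sm_integral s w; have [i2 <-] := inner_sm_integral s' w.
rewrite -RintegralB// -RintegralZr//; apply: le_Rintegral => //.
- rewrite /comp; under eq_fun do rewrite EFinB; exact: integrableB.
- rewrite (_ : _ \o _ = fun x => (h x)%:E * (nrm w)%:E)%E.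
    exact: integrableZr.
  by apply/funext => x /=; rewrite EFinM.
- move=> x Dx; rewrite -innerBl; apply: le_trans (ler_norm _) _.
  by apply: le_trans (cauchy_schwarz _ _ _) _; rewrite ler_wpM2r ?snorm_ge0// sh.
Qed.

Lemma bochner_distP (g : R -> H) y : is_bochner_integral D g y ->
  exists s : nat -> simple_map mu D,
  [/\ forall k, lebesgue_measure.-integrable D
        (fun x => (nrm (g x - sm_eval (s k) x))%:E),
      \int[lebesgue_measure]_(x in D) nrm (g x - sm_eval (s k) x)
        @[k --> \oo] --> (0 : R)
    & nrm (y - sm_integral (s k)) @[k --> \oo] --> (0 : R)].
Proof.
move=> [s [si sg sy]]; exists s; split.
- by move=> k; move: (si k); under eq_fun do rewrite L2normE.
- move: sg; under eq_fun do under eq_Rintegral do rewrite L2normE.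
  by [].
- by move: sy; under eq_fun do rewrite L2normE.
Qed.

(** For each approximating map [sk k], compare its integral with that of [s] under the majorant
    [nrm (g - sk k) + h], then let [k] tend to infinity. *)
Lemma bochner_dist_simple (g : R -> H) y s (h : R -> R) :
  is_bochner_integral D g y ->
  lebesgue_measure.-integrable D (EFin \o h) ->
  (forall x, D x -> nrm (g x - sm_eval s x) <= h x) ->
  nrm (y - sm_integral s) <= \int[lebesgue_measure]_(x in D) h x.
Proof.
move=> /bochner_distP[sk [ski skg sky]] ih gh.
set I := \int[_]_(x in D) h x.
pose u k := nrm (y - sm_integral (sk k)) +
  (\int[lebesgue_measure]_(x in D) nrm (g x - sm_eval (sk k) x) + I).
have uI : u k @[k --> \oo] --> I.
  rewrite -[X in _ --> X]add0r -[X in _ --> 0 + X]add0r.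
  by apply: cvgD => //; apply: cvgD => //; exact: cvg_cst.
rewrite -(cvg_lim _ uI)//; apply: limr_ge; first exact: cvgP uI.
apply: nearW => k; apply: le_trans (snorm_distD _ (sm_integral (sk k)) _ _) _.
rewrite lerD2l /I -RintegralD//; last exact: ski.
apply: (@snorm_sm_integralB _ _ (fun x => nrm (g x - sm_eval (sk k) x) + h x)).
  rewrite (_ : _ \o _ = fun x => (nrm (g x - sm_eval (sk k) x))%:E + (h x)%:E)%E.
    exact: integrableD.
  by apply/funext => x /=; rewrite EFinD.
move=> x Dx; apply: le_trans (snorm_distD _ (g x) _ _) _.
by rewrite snorm_distC lerD2l gh.
Qed.

(** Since [g x] is orthogonal to [w], the pairing of an approximating simple map with [w] is
    controlled by its distance to [g x]. This gives necessity: a mode that the control does not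
    excite stays unexcited. *)
Lemma bochner_inner0 (g : R -> H) y w : is_bochner_integral D g y ->
  (forall x, D x -> dot (g x) w = 0) -> dot y w = 0.
Proof.
move=> /bochner_distP[sk [ski skg sky]] g0.
pose u k := (nrm (y - sm_integral (sk k)) +
  \int[lebesgue_measure]_(x in D) nrm (g x - sm_eval (sk k) x)) * nrm w.
have u0 : u k @[k --> \oo] --> (0 : R).
  rewrite -(mul0r (nrm w)) -[X in X * _](addr0 0).
  by apply: cvgM; [exact: cvgD|exact: cvg_cst].
apply/eqP; rewrite -normr_le0 -(cvg_lim _ u0)//.
apply: limr_ge; first exact: cvgP u0.
apply: nearW => k; rewrite -[y](subrK (sm_integral (sk k))) innerDl /u.
rewrite mulrDl; apply: le_trans (ler_normD _ _) _; apply: lerD.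
  exact: cauchy_schwarz.
have [i1 <-] := inner_sm_integral (sk k) w.
apply: le_trans (le_normr_Rintegral mD i1) _.
rewrite -RintegralZr//; last exact: ski.
apply: le_Rintegral => //.
- exact: integrable_norm.
- rewrite (_ : _ \o _ = fun x =>
      (nrm (g x - sm_eval (sk k) x))%:E * (nrm w)%:E)%E.
    exact: integrableZr.
  by apply/funext => x /=; rewrite EFinM.
- move=> x Dx; apply: le_trans (cauchy_schwarz _ _ _).
  by rewrite innerBl g0// sub0r normrN.
Qed.

Hypothesis fD : (lebesgue_measure D < +oo)%E.

Lemma integrable_cst_finite (c : R) :
  lebesgue_measure.-integrable D (fun=> c%:E).
Proof.
apply/integrableP; split; first exact: measurable_cst.
by rewrite integral_cst// lte_mul_pinfty.
Qed.

(** On a set of finite measure, uniform approximation at a geometric rate makes the integrals of the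
    simple maps converge at the same rate, so [L2_complete] applies. *)
Lemma bochner_exists (g : R -> H) (s : nat -> simple_map mu D) C :
  (forall k x, D x -> nrm (g x - sm_eval (s k) x) <= C / 4 ^+ k) ->
  exists y, is_bochner_integral D g y.
Proof.
move=> gC.
have CV c : c / 4 ^+ k @[k --> \oo] --> (0 : R).
  rewrite (_ : (fun _ => _) = geometric c 4^-1).
    by apply: cvg_geometric; rewrite ger0_norm// invf_lt1// ltr1n.
  by apply/funext => k; rewrite /geometric/= exprVn.
(* This makes the distance from [g] to [s k] measurable, as a pointwise limit of distances between
   simple maps. *)
have gcv x : D x -> forall k,
    nrm (sm_eval (s l) x - sm_eval (s k) x) @[l --> \oo] -->
    nrm (g x - sm_eval (s k) x).
  move=> Dx k; apply/cvgrPdist_le => e e0.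
  have /cvgrPdist_le/(_ _ e0) := CV C; apply: filterS => l.
  rewrite sub0r normrN => /(le_trans (ler_norm _)) Ce.
  rewrite ler_distl; apply/andP; split.
  - rewrite lerBlDr; apply: le_trans (snorm_distD _ (g x) _ _) _.
    by rewrite addrC lerD2l// snorm_distC; apply: le_trans (gC _ _ Dx) Ce.
  - apply: le_trans (snorm_distD _ (sm_eval (s l) x) _ _) _.
    by rewrite addrC lerD2l//; apply: le_trans (gC _ _ Dx) Ce.
have ig k : lebesgue_measure.-integrable D
    (fun x => (nrm (g x - sm_eval (s k) x))%:E).
  apply: le_integrable (integrable_cst_finite (C / 4 ^+ k)) => //.
    apply/measurable_EFinP.
    apply: (@measurable_fun_cvg _ _ _ _
      (fun l x => nrm (sm_eval (s l) x - sm_eval (s k) x))) => [l|x Dx].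
      by apply: measurable_funTS; exact: measurable_snorm_simple.
    exact: gcv.
  move=> x Dx; rewrite lee_fin ger0_norm ?snorm_ge0//.
  exact: le_trans (gC _ _ Dx) (ler_norm _).
pose L := fine (lebesgue_measure D).
have [y yP] : exists y, forall n,
    nrm (y - sm_integral (s n)) <= 2 * (2 * C * L) / 4 ^+ n.
  apply: L2_complete => k.
  rewrite (_ : 2 * C * L / 4 ^+ k = 2 * C / 4 ^+ k * L); last by ring.
  rewrite -Rintegral_cst//; apply: snorm_sm_integralB.
    exact: integrable_cst_finite.
  move=> x Dx; apply: le_trans (snorm_distD _ (g x) _ _) _.
  rewrite snorm_distC; apply: le_trans (lerD (gC _ _ Dx) (gC _ _ Dx)) _.
  have C0 : 0 <= C / 4 ^+ k by apply: le_trans (gC k _ Dx); exact: snorm_ge0.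
  by rewrite exprS invfM -mulrA; lra.
exists y, s; split.
- by move=> k; under eq_fun do rewrite L2normE; exact: ig.
- under eq_fun do under eq_Rintegral do rewrite L2normE.
  apply: (@squeeze_cvgr _ _ _ _ (fun=> 0) (fun k => C * L / 4 ^+ k));
    [|exact: cvg_cst|exact: CV].
  apply: nearW => k; rewrite Rintegral_ge0 => [|x _]; last exact: snorm_ge0.
  rewrite mulrAC -Rintegral_cst//; apply: le_Rintegral => //.
  - exact: ig.
  - exact: integrable_cst_finite.
  - by move=> x Dx; exact: gC.
- under eq_fun do rewrite L2normE.
  apply: (@squeeze_cvgr _ _ _ _ (fun=> 0) (fun k => 2 * (2 * C * L) / 4 ^+ k));
    [|exact: cvg_cst|exact: CV].
  by apply: nearW => k; rewrite yP snorm_ge0.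
Qed.
End bochner.

(** * Semigroups and their eigenvectors *)

Section multiplicative_functions.
Context (R : realType).

Lemma ler_normrXB (a b K : R) n : `|a| <= K -> `|b| <= K ->
  `|a ^+ n.+1 - b ^+ n.+1| <= n.+1%:R * K ^+ n * `|a - b|.
Proof.
move=> aK bK; rewrite subrXX normrM mulrC ler_wpM2r//.
apply: (le_trans (ler_norm_sum _ _ _)).
rewrite mulr_natl -[n.+1 in leRHS]card_ord -sumr_const; apply: ler_sum => i _.
have K0 := le_trans (normr_ge0 _) aK.
rewrite normrM !normrX.
have -> : K ^+ n = K ^+ (n - i) * K ^+ i by rewrite -exprD subnK// -ltnS.
by rewrite ler_pM ?exprn_ge0// lerXn2r ?nnegrE.
Qed.

(** The upper estimate comes from [1 - x <= expR (- x)], that is [expR x * (1 - x) <= 1]. *)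
Lemma expR_1Dx_le (x : R) : `|x| <= 2^-1 -> `|expR x - 1 - x| <= 2 * x ^+ 2.
Proof.
move=> x2; have x1 : x <= 2^-1 by exact: le_trans (ler_norm _) x2.
have := expR_ge1Dx x; have := expR_ge1Dx (- x).
rewrite expRN => h1 h2.
rewrite ger0_norm; last by lra.
have e0 := expR_gt0 x.
have : expR x * (1 - x) <= 1.
  have := ler_wpM2l (ltW e0) h1; rewrite divff ?gt_eqF//; lra.
by rewrite expr2; nra.
Qed.

(* [c t = c (t / n) ^+ n], compared with [expR (m * t / n) ^+ n]. *)
Lemma multiplicative_expR (c : R -> R) (m : R) :
  (forall s t, 0 <= s -> 0 <= t -> c (s + t) = c s * c t) -> c 0 = 1 ->
  (forall e : R, 0 < e -> exists2 d, 0 < d &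
    forall h, 0 < h -> h < d -> `|c h - 1 - m * h| <= e * h) ->
  forall t, 0 <= t -> c t = expR (m * t).
Proof.
move=> cD c0 c' t; rewrite le_eqVlt => /predU1P[<-|t0].
  by rewrite mulr0 expR0.
have cX h n : 0 <= h -> c (n%:R * h) = c h ^+ n.
  move=> h0; elim: n => [|n IH]; first by rewrite mul0r c0.
  by rewrite -natr1 mulrDl mul1r cD ?mulr_ge0// IH exprSr.
apply/eqP; rewrite -subr_eq0 -normr_le0; apply/ler_addgt0Pr => e e0; rewrite add0r.
pose K := expR ((`|m| + 1) * t); have K0 : 0 < K by exact: expR_gt0.
(* The final error is [2 * t * K * e'], where [K] bounds the [n]-th powers of both [c h] and
   [expR (m * h)]. *)
pose e' := Num.min (e / (2 * t * K)) 2^-1.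
have e'0 : 0 < e' by rewrite lt_min invr_gt0 ltr0n andbT divr_gt0 ?mulr_gt0.
have [d d0 cd] := c' _ e'0.
(* The three bounds on [h] give the estimate on [c h], then [|m * h| <= 1 / 2], and
   [2 * m ^+ 2 * h <= e'] for the error of the exponential. *)
pose d' := Num.min d (Num.min (2^-1 / (`|m| + 1)) (e' / (2 * m ^+ 2 + 1))).
have m1 : 0 < `|m| + 1 by rewrite ltr_wpDl.
have m2 : 0 < 2 * m ^+ 2 + 1 by rewrite ltr_wpDl// mulr_ge0 ?sqr_ge0.
have d'0 : 0 < d' by rewrite !lt_min d0 !divr_gt0.
pose n := Num.truncn (t / d'); pose h := t / n.+1%:R.
have hd : h < d'.
  by rewrite /h ltr_pdivrMr// mulrC -ltr_pdivrMr// truncnS_gt.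
have h0 : 0 < h by rewrite divr_gt0.
have tE : t = n.+1%:R * h by rewrite /h mulrC divfK.
move: hd; rewrite !lt_min => /and3P[hd hm hm2].
have ch := cd h h0 hd.
have mh : `|m * h| <= 2^-1.
  rewrite normrM (gtr0_norm h0); move: hm; rewrite ltr_pdivlMr//; nra.
have eh := expR_1Dx_le mh.
have eh' : `|expR (m * h) - 1 - m * h| <= e' * h.
  apply: le_trans eh _; rewrite exprMn.
  move: hm2; rewrite ltr_pdivlMr// => hm2; rewrite [h ^+ 2]expr2.
  have : h * (2 * m ^+ 2) <= e' by lra.
  by move=> /(ler_wpM2r (ltW h0)); lra.
have che : `|c h - expR (m * h)| <= 2 * e' * h.
  rewrite (_ : c h - _ = (c h - 1 - m * h) - (expR (m * h) - 1 - m * h)).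
    by apply: le_trans (ler_normB _ _) _; lra.
  by ring.
pose k := expR ((`|m| + 1) * h).
have kh : expR (`|m| * h) + h <= k.
  rewrite /k mulrDl mul1r expRD.
  have := expR_ge1Dx h; have : 1 <= expR (`|m| * h).
    by rewrite -expR0 ler_expR mulr_ge0// ltW.
  by nra.
have ek : expR (m * h) <= expR (`|m| * h).
  by rewrite ler_expR ler_pM2r// ler_norm.
have e'2 : e' <= 2^-1 by rewrite ge_min lexx orbT.
have c1 : `|c h| <= k.
  rewrite -[c h](subrK (expR (m * h))); apply: le_trans (ler_normD _ _) _.
  by rewrite [`|expR _|]gtr0_norm ?expR_gt0//; nra.
have c2 : `|expR (m * h)| <= k by rewrite gtr0_norm ?expR_gt0//; lra.
rewrite {1 2}tE (cX _ _ (ltW h0)) mulrCA expRM_natl.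
apply: le_trans (ler_normrXB n c1 c2) _.
have kK : k ^+ n <= K.
  rewrite /k -expRM_natl /K ler_expR tE mulrCA ler_pM2l//.
  by rewrite (ler_wpM2r (ltW h0))// ler_nat leqnSn.
apply: (@le_trans _ _ (n.+1%:R * K * (2 * e' * h))).
  by rewrite ler_pM ?mulr_ge0 ?ler_wpM2l ?exprn_ge0 ?expR_ge0.
rewrite (_ : _ * _ = 2 * (n.+1%:R * h) * K * e'); last by ring.
rewrite -tE mulrC -ler_pdivlMr ?mulr_gt0//.
by rewrite /e' ge_min lexx.
Qed.
End multiplicative_functions.

(** This replaces rewriting under a norm when two vectors agree only against every test vector. *)
Lemma snorm_eq (R : realType) (V : lmodType R) (dot : semi_inner V) f g :
  (forall h, dot f h = dot g h) -> snorm dot f = snorm dot g.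
Proof.
move=> fg; apply: snorm_eq_dist0; rewrite /snorm innerBl fg subrr.
exact: sqrtr0.
Qed.

Section semigroup.
Context d (X : measurableType d) (R : realType) (mu : {measure set X -> \bar R}).
Local Notation H := (L2 mu).
Local Notation dot := (L2_inner mu).
Local Notation nrm := (snorm dot).
Variable S : R -> H -> H.
Hypothesis Sg : C0_semigroup S.
Implicit Types (f g h : H) (t a : R).

Lemma inner_ae f g h : f = g %[ae mu] -> dot f h = dot g h.
Proof. by move=> /snorm_ae; exact: inner_dist0. Qed.

Lemma inner_semigroup t a f g h : 0 <= t ->
  dot (S t (a *: f + g)) h = a * dot (S t f) h + dot (S t g) h.
Proof.
by move=> t0; rewrite (inner_ae _ (semigroup_linear Sg a f g t0)) innerP.
Qed.

Lemma inner_semigroup0 t h : 0 <= t -> dot (S t 0) h = 0.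
Proof.
move=> t0; have := inner_semigroup (-1) 0 0 h t0.
by rewrite scaler0 addr0 mulN1r addNr.
Qed.

Lemma inner_semigroupZ t a f h : 0 <= t -> dot (S t (a *: f)) h = a * dot (S t f) h.
Proof.
by move=> t0; rewrite -[a *: f]addr0 inner_semigroup// inner_semigroup0// addr0.
Qed.

Lemma inner_semigroupB t f g h : 0 <= t ->
  dot (S t (f - g)) h = dot (S t f) h - dot (S t g) h.
Proof.
move=> t0; rewrite addrC -scaleN1r inner_semigroup//.
by rewrite mulN1r addrC.
Qed.

Lemma inner_semigroup_sum t n (c : 'I_n -> R) (f : 'I_n -> H) h : 0 <= t ->
  dot (S t (\sum_(i < n) c i *: f i)) h = \sum_(i < n) c i * dot (S t (f i)) h.
Proof.
move=> t0; elim: n c f => [|n IH] c f; first by rewrite !big_ord0 inner_semigroup0.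
by rewrite !big_ord_recl inner_semigroup// IH.
Qed.

Lemma snorm_semigroupB t f g : 0 <= t -> nrm (S t f - S t g) = nrm (S t (f - g)).
Proof.
by move=> t0; apply: snorm_eq => h; rewrite innerBl inner_semigroupB.
Qed.

Lemma snorm_semigroup_le t : 0 <= t ->
  exists2 C, 0 < C & forall f, nrm (S t f) <= C * nrm f.
Proof.
move=> /(semigroup_bounded Sg)[C SC]; exists (`|C| + 1); first by rewrite ltr_wpDl.
move=> f; have := SC f; rewrite !L2normE => /le_trans; apply.
by rewrite ler_wpM2r ?snorm_ge0// (le_trans (ler_norm _))// lerDl.
Qed.

(** Boundedness makes [S t] respect null differences, so that it descends to classes. *)
Lemma inner_semigroup_congr t f g h : 0 <= t -> (forall k, dot f k = dot g k) ->
  dot (S t f) h = dot (S t g) h.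
Proof.
move=> t0 fg; apply: inner_dist0; rewrite snorm_semigroupB//.
have [C _ SC] := snorm_semigroup_le t0.
have fg0 : nrm (f - g) = 0.
  by rewrite -(snorm0 dot); apply: snorm_eq => k; rewrite innerBl fg subrr inner0l.
by apply/eqP; rewrite eq_le snorm_ge0 andbT (le_trans (SC _))// fg0 mulr0.
Qed.

Lemma inner_semigroupD s t f h : 0 <= s -> 0 <= t ->
  dot (S (s + t) f) h = dot (S s (S t f)) h.
Proof. by move=> s0 t0; exact/inner_ae/(semigroupD Sg). Qed.

Lemma cvg_at_right0P (u : R -> R) : u t @[t --> 0^'+] --> (0 : R) ->
  forall e : R, 0 < e -> exists2 r, 0 < r & forall t, 0 < t -> t < r -> `|u t| <= e.
Proof.
move=> /cvgrPdist_le u0 e /u0 [r /= r0 ur]; exists r => // t t0 tr.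
have := ur t; rewrite sub0r normrN; apply => //.
by rewrite /= sub0r normrN gtr0_norm.
Qed.

Section generator.
Variable A : H -> H -> Prop.
Hypothesis SA : generated_by S A.

(** [S t] commutes with [S h], so the difference quotient at [S t f] is the image under [S t] of the
    one at [f]. *)
Lemma eigenvector_orbit m f t : 0 <= t -> A f (m *: f) -> A (S t f) (m *: S t f).
Proof.
move=> t0 /SA fm; apply/SA.
have [C C0 SC] := snorm_semigroup_le t0.
apply/cvgrPdist_le => e e0.
have [r r0 fr] := cvg_at_right0P fm (divr_gt0 e0 C0).
near=> h; have h0 : 0 < h by near: h; exact: nbhs_right_gt.
have hr : h < r by near: h; exact: nbhs_right_lt.
have := fr h h0 hr.
rewrite sub0r normrN !L2normE !ger0_norm ?snorm_ge0// ler_pdivlMr// mulrC.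
apply: le_trans; apply: le_trans (SC _).
rewrite le_eqVlt; apply/orP; left; apply/eqP; apply: snorm_eq => k.
rewrite inner_semigroupB// !inner_semigroupZ// inner_semigroupB//.
rewrite innerBl !innerZl innerBl -(inner_semigroupD _ _ (ltW h0) t0).
rewrite -(inner_semigroupD _ _ t0 (ltW h0)).
by rewrite (addrC h t).
Unshelve. all: by end_near. Qed.

Lemma eigenvector_semigroup m f t : 0 <= t -> nrm f = 1 ->
  is_eigenfunction A m f -> is_simple_eigenvalue A m ->
  forall h, dot (S t f) h = expR (m * t) * dot f h.
Proof.
move=> t0 f1 [fn0 Af] [_ simple].
have f2 : dot f f = 1 by rewrite -snorm_sqr f1 expr1n.
have Sc s h : 0 <= s -> dot (S s f) h = dot (S s f) f * dot f h.
  move=> s0; suff [c cE] : exists c, forall h, dot (S s f) h = c * dot f h.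
    by rewrite !cE f2 mulr1.
  (* A null [S s f] is not an eigenfunction, so simplicity says nothing about it; the factor is then
     0. *)
  have [S0|Sn0] := pselect (S s f = cst 0 %[ae mu]).
    exists 0 => k; rewrite mul0r -(inner0l dot k); apply: inner_ae.
    exact: S0.
  have [|c Sc] := simple f (S s f) (conj fn0 Af).
    by split => //; exact: eigenvector_orbit.
  by exists c => k; rewrite (inner_ae _ Sc) innerZl.
move=> h; rewrite Sc//; congr (_ * _).
apply: (@multiplicative_expR _ (fun t => dot (S t f) f)) => //.
- move=> s r s0 r0; rewrite inner_semigroupD//.
  rewrite (@inner_semigroup_congr _ _ (dot (S r f) f *: f))//.
    by rewrite inner_semigroupZ// mulrC.
  by move=> k; rewrite Sc// innerZl.
- by rewrite (inner_ae _ (semigroup0 Sg f)) f2.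
- move=> e e0; have /SA/cvg_at_right0P/(_ e e0)[r r0 Sr] := Af.
  exists r => // s s0 sr; have := Sr s s0 sr.
  rewrite L2normE ger0_norm ?snorm_ge0// => Se.
  have -> : dot (S s f) f - 1 - m * s = s * dot (s^-1 *: (S s f - f) - m *: f) f.
    rewrite innerBl !innerZl innerBl f2 mulrBr mulrA divff ?gt_eqF//; ring.
  rewrite normrM gtr0_norm// mulrC; apply: (ler_wpM2r (ltW s0)).
  by apply: le_trans (cauchy_schwarz _ _ _) _; rewrite f1 mulr1.
Qed.

Section basis.
Variables (m : nat -> R) (e : nat -> H).
Hypothesis e_basis : hilbert_basis e.
Hypothesis e_eigen : forall j, is_eigenfunction A (m j) (e j).
Hypothesis m_simple : forall j, is_simple_eigenvalue A (m j).

Lemma basis_orthonormal i j : dot (e i) (e j) = (i == j)%:R.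
Proof. exact: e_basis.1. Qed.

Lemma basis_total f (eps : R) : 0 < eps ->
  exists (N : nat) (c : 'I_N -> R), nrm (f - \sum_(j < N) c j *: e j) <= eps.
Proof.
by move=> /(e_basis.2 f)[N [c]]; rewrite L2normE; exists N, c.
Qed.

(** Both sides agree on finite combinations of the basis and are continuous in [f], hence agree
    everywhere. *)
Lemma semigroup_coord t f j : 0 <= t ->
  dot (S t f) (e j) = expR (m j * t) * dot f (e j).
Proof.
move=> t0; apply/eqP; rewrite -subr_eq0 -normr_le0; apply/ler_addgt0Pr => eps eps0.
have [C C0 SC] := snorm_semigroup_le t0.
have E i k := eigenvector_semigroup t0 (snorm_basis basis_orthonormal i)
  (e_eigen i) (m_simple i) k.
have CE : 0 < C + expR (m j * t) by rewrite addr_gt0 ?expR_gt0.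
have [N [c fc]] := basis_total f (divr_gt0 eps0 CE).
set p := \sum_(_ < _) _ in fc.
have pE : dot (S t p) (e j) = expR (m j * t) * dot p (e j).
  rewrite inner_semigroup_sum// inner_suml mulr_sumr; apply: eq_bigr => i _.
  rewrite E innerZl basis_orthonormal.
  by have [->|_] := eqVneq (i : nat) j; rewrite ?mulr0// !mulr1 mulrC.
have -> : dot (S t f) (e j) - expR (m j * t) * dot f (e j) =
    dot (S t (f - p)) (e j) - expR (m j * t) * dot (f - p) (e j).
  by rewrite inner_semigroupB// pE innerBl; ring.
rewrite add0r; apply: (le_trans (ler_normB _ _)).
apply: (@le_trans _ _ ((C + expR (m j * t)) * nrm (f - p))); last first.
  by rewrite mulrC -ler_pdivlMr.
rewrite mulrDl normrM (gtr0_norm (expR_gt0 _)); apply: lerD.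
  apply: le_trans (cauchy_schwarz _ _ _) _.
  by rewrite (snorm_basis basis_orthonormal) mulr1 SC.
rewrite ler_wpM2l ?expR_ge0//; apply: le_trans (cauchy_schwarz _ _ _) _.
by rewrite (snorm_basis basis_orthonormal) mulr1.
Qed.

(** [expR (m j)] is the [j]-th coordinate of [S 1 (e j)], hence at most a bound of [S 1]. *)
Lemma eigenvalues_bounded : exists M, forall j, m j <= M.
Proof.
have [C C0 SC] := snorm_semigroup_le (ler01 : 0 <= 1 :> R).
exists (ln C) => j; rewrite -ler_expR lnK ?posrE//.
have := cauchy_schwarz dot (S 1 (e j)) (e j).
rewrite semigroup_coord// basis_orthonormal eqxx !mulr1.
rewrite (snorm_basis basis_orthonormal) mulr1 => /(le_trans (ler_norm _)).
move=> /le_trans; apply; rewrite (le_trans (SC _))//.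
by rewrite (snorm_basis basis_orthonormal) mulr1.
Qed.

Lemma eigenvalues_inj : injective m.
Proof.
move=> i j mij; apply/eqP; apply: contraT => ij.
have := (m_simple i).2 _ _ (e_eigen i).
rewrite mij => /(_ _ (e_eigen j))[c ec].
have := inner_ae (e j) ec.
rewrite innerZl !basis_orthonormal eqxx (negbTE ij) mulr0 => /eqP.
by rewrite oner_eq0.
Qed.

(** The definition of a semigroup bounds each [S t] separately; the diagonal form makes the bound
    uniform in [t]. *)
Lemma semigroup_uniform_bound T : exists2 C, 0 < C & forall t f, 0 <= t <= T ->
  nrm (S t f) <= C * nrm f.
Proof.
have [M mM] := eigenvalues_bounded.
exists (expR (`|M| * T)); first exact: expR_gt0.
move=> t f /andP[t0 tT]; apply: (le_snorm_basis basis_orthonormal basis_total).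
  exact: expR_ge0.
move=> j; rewrite semigroup_coord// normrM ler_wpM2r// gtr0_norm ?expR_gt0//.
rewrite ler_expR (@le_trans _ _ (`|M| * t))// ?ler_wpM2l//.
by rewrite ler_wpM2r// (le_trans (mM j))// ler_norm.
Qed.

(** As [S t f - S s f] amounts to [S s (S (t - s) f - f)], continuity at 0 and the uniform bound
    suffice. *)
Lemma semigroup_uniformly_continuous T f (eps : R) : 0 < eps -> exists2 r, 0 < r &
  forall s t, 0 <= s -> s <= t -> t <= T -> t - s < r -> nrm (S t f - S s f) <= eps.
Proof.
move=> eps0; have [C C0 SC] := semigroup_uniform_bound T.
have /cvg_at_right0P/(_ _ (divr_gt0 eps0 C0))[r r0 Sr] := semigroup_continuous Sg f.
exists r => // s t s0; rewrite le_eqVlt => /predU1P[->|st] tT tsr.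
  by rewrite subrr snorm0 ltW.
have ts0 : 0 < t - s by rewrite subr_gt0.
have := Sr _ ts0 tsr; rewrite L2normE ger0_norm ?snorm_ge0// => SC'.
apply: (@le_trans _ _ (C * nrm (S (t - s) f - f))).
  have sT : 0 <= s <= T by rewrite s0 (le_trans (ltW st)).
  apply: le_trans (SC s _ sT).
  rewrite -(snorm_semigroupB _ _ s0).
  suff -> : nrm (S t f - S s f) = nrm (S s (S (t - s) f) - S s f) by [].
  apply: snorm_eq => h.
  by rewrite !innerBl -(inner_semigroupD _ _ s0 (ltW ts0)) subrKC.
by rewrite mulrC -ler_pdivlMr//.
Qed.

End basis.
End generator.
End semigroup.

(** * Step controls *)

Section step_control.
Context (R : realType) (T : R).

Lemma Lfun2_indic_control (J : set (measurableTypeR R)) : measurable J ->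
  (\1_J : R -> R) \in
    Lfun (mrestr (@lebesgue_measure R) (measurable_itv `]0, T[)) 2%:E.
Proof.
move=> mJ; apply: Lfun2P; first exact: measurable_indic.
rewrite (_ : (fun _ => _) = EFin \o \1_J); last first.
  by apply/funext => x; rewrite /= indicE; case: (x \in J); rewrite ?expr1n ?expr0n.
rewrite integral_indic// setIT /mrestr.
apply: (@le_lt_trans _ _ (lebesgue_measure (`]0, T[%classic : set (measurableTypeR R)))).
  by apply: le_measure; rewrite ?inE//; exact: measurableI.
by rewrite lebesgue_measure_itv/=; case: ifP => _; rewrite -?EFinB ltry.
Qed.

Variables (n : nat) (a : 'I_n -> R) (J : 'I_n -> set (measurableTypeR R)).
Hypothesis mJ : forall i, measurable (J i).

Definition step_control : control T :=
  \sum_i a i *: Lfun_Sub (@lee1n R 2) (Lfun2_indic_control (mJ i)).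

Lemma step_controlE x : step_control x = \sum_i a i * \1_(J i) x.
Proof.
rewrite /step_control.
by rewrite (big_morph (fun f : control T => f x) (id1 := 0) (op1 := +%R)).
Qed.
End step_control.

Arguments inner : simpl never.

(** * Mild solutions driven by step controls *)

Section orbit_integrals.
Context d (X : measurableType d) (R : realType) (mu : {measure set X -> \bar R}).
Local Notation H := (L2 mu).
Local Notation dot := (L2_inner mu).
Local Notation nrm := (snorm dot).

Lemma simple_map_of_family (D : set (measurableTypeR R)) (K : finType)
    (A : K -> set (measurableTypeR R)) (v : K -> H) :
  measurable D -> (lebesgue_measure D < +oo)%E -> (forall k, measurable (A k)) ->
  exists s : simple_map mu D, (forall x, sm_eval s x = \sum_k \1_(A k) x *: v k) /\
    sm_integral s = \sum_k fine (lebesgue_measure (D `&` A k)) *: v k.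
Proof.
move=> mD fD mA.
have fA k : (lebesgue_measure (D `&` A k) < +oo)%E.
  apply: le_lt_trans fD; apply: le_measure; rewrite ?inE//; exact: measurableI.
exists (@SimpleMap _ _ _ _ D #|K| (fun i => A (enum_val i)) (fun i => v (enum_val i))
  (fun i => mA (enum_val i)) (fun i => fA (enum_val i))).
split=> [x|].
  by rewrite /sm_eval/= -(big_enum_val (fun k => \1_(A k) x *: v k)).
rewrite /sm_integral/=.
by rewrite -(big_enum_val (fun k => fine (lebesgue_measure (D `&` A k)) *: v k)).
Qed.

Variables (S : R -> H -> H) (T : R) (b : H).
Hypothesis Sg : C0_semigroup S.
Hypothesis Sb_continuous : forall eps : R, 0 < eps -> exists2 r, 0 < r &
  forall s t : R, 0 <= s -> s <= t -> t <= T -> t - s < r -> nrm (S t b - S s b) <= eps.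

(** Cut []0, t[] into cells shorter than the modulus of continuity and freeze the orbit at the left
    end of each; the simple map is indexed by pairs (piece of the control, cell). *)
Lemma bochner_step_orbit n (a : 'I_n -> R) (J : 'I_n -> set (measurableTypeR R))
    (u : R -> R) (t : R) : (forall i, measurable (J i)) ->
  (forall x, u x = \sum_i a i * \1_(J i) x) -> 0 <= t <= T ->
  exists y, is_bochner_integral `]0, t[ (fun s => S (t - s) (u s *: b)) y.
Proof.
move=> mJ uE /andP[t0 tT].
pose D : set (measurableTypeR R) := `]0, t[%classic.
have mD : measurable D by exact: measurable_itv.
have fD : (lebesgue_measure D < +oo)%E.
  by rewrite lebesgue_measure_itv/=; case: ifP => _; rewrite -?EFinB ltry.
pose U := \sum_i `|a i| + 1.
have U0 : 0 < U by rewrite ltr_wpDl// sumr_ge0.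
have uU x : `|u x| <= U.
  rewrite uE (le_trans (ler_norm_sum _ _ _))// (@le_trans _ _ (\sum_i `|a i|))//.
    apply: ler_sum => i _; rewrite normrM ler_piMr//.
    by rewrite indicE; case: (x \in J i); rewrite ?normr1 ?normr0.
  by rewrite lerDl.
suff /choice[s sP] : forall k, exists s : simple_map mu D, forall x, D x ->
    nrm (S (t - x) (u x *: b) - sm_eval s x) <= 1 / 4 ^+ k.
  exact: (bochner_exists mD fD sP).
move=> k.
have ek : 0 < 1 / 4 ^+ k / U :> R by rewrite !divr_gt0// exprn_gt0.
have [r r0 Sr] := Sb_continuous ek.
pose N := (Num.truncn (t / r)).+1; pose h := t / N%:R.
have hr : h < r.
  by rewrite /h ltr_pdivrMr// mulrC -ltr_pdivrMr// truncnS_gt.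
pose I (i : 'I_N) : set (measurableTypeR R) := `[i%:R * h, i.+1%:R * h[%classic.
have [s [sE _]] := @simple_map_of_family D ('I_n * 'I_N)%type
  (fun p => J p.1 `&` I p.2) (fun p => a p.1 *: S (t - p.2%:R * h) b) mD fD
  (fun p => measurableI _ _ (mJ p.1) (measurable_itv _)).
exists s => x; rewrite /D/= in_itv/= => /andP[x0 xt].
have tp : 0 < t by exact: lt_trans xt.
have N0 : 0 < N%:R :> R by rewrite ltr0n.
have h0 : 0 < h by rewrite divr_gt0.
have tE : N%:R * h = t by rewrite /h mulrC divfK// gt_eqF.
have xh0 : 0 <= x / h by rewrite divr_ge0// ltW.
have iN : (Num.truncn (x / h) < N)%N.
  by rewrite truncn_lt_nat// ltr_pdivrMr// tE.
pose i0 := Ordinal iN.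
have xi0 : i0%:R * h <= x < i0.+1%:R * h.
  rewrite -ler_pdivlMr// -ltr_pdivrMr//.
  exact: truncn_itv.
have Ii0 i : \1_(I i) x = (i == i0)%:R :> R.
  rewrite indicE; congr (_%:R); congr nat_of_bool; apply/idP/eqP.
    rewrite inE /I/= in_itv/= -ler_pdivlMr// -ltr_pdivrMr// => xi.
    by apply/val_inj/esym/eqP => /=; rewrite truncn_eq.
  by move=> ->; rewrite inE /I/= in_itv/=.
have -> : nrm (S (t - x) (u x *: b) - sm_eval s x) =
    nrm (u x *: (S (t - x) b - S (t - i0%:R * h) b)).
  apply: snorm_eq => w; have tx : 0 <= t - x by rewrite subr_ge0 ltW.
  rewrite innerBl innerZl innerBl inner_semigroupZ// mulrBr; congr (_ - _).
  rewrite sE inner_suml uE mulr_suml.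
  rewrite -(pair_bigA _ (fun l i =>
    dot (\1_(J l `&` I i) x *: (a l *: S (t - i%:R * h) b)) w))/=.
  apply: eq_bigr => l _.
  rewrite (bigD1 i0)//= big1 ?addr0 => [|i ii0].
    by rewrite !innerZl indicI/= Ii0 eqxx mulr1 mulrA (mulrC (\1_ _ _)).
  by rewrite innerZl indicI/= Ii0 (negbTE ii0) mulr0 mul0r.
rewrite snormZ (le_trans (ler_wpM2r (snorm_ge0 _ _) (uU x)))//.
rewrite mulrC -ler_pdivlMr//; have /andP[xi1 xi2] := xi0.
rewrite snorm_distC; apply: Sr.
- by rewrite subr_ge0 ltW.
- by rewrite lerD2l lerN2.
- by rewrite (le_trans _ tT)// gerBl mulr_ge0// ltW.
- apply: le_lt_trans hr; move: xi2; rewrite -(natr1 i0); lra.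
Qed.

(* The control takes the value [c / eta] on an interval of length [eta] that starts
   at [T - tau]; as [eta] tends to 0 it steers 0 to a state close to [c *: S tau b]. *)
Lemma steer_orbit_comb (s : seq (R * R)) (z0 z1 : H) (eps : R) : 0 <= T -> 0 < eps ->
  (forall p, p \in s -> 0 < p.2 < T) ->
  nrm (z1 - S T z0 - orbit_comb (fun t => S t b) s) <= eps ->
  exists (u : control T) (z : R -> H),
    mild_solution S (fun c => c *: b) u z0 z /\ nrm (z T - z1) <= eps + eps.
Proof.
move=> T0 eps0 sT zs.
pose n := size s; pose c (i : 'I_n) := (tnth (in_tuple s) i).1.
pose tau (i : 'I_n) := (tnth (in_tuple s) i).2.
have tauT i : 0 < tau i < T by apply: sT; exact: mem_tnth.
pose C := \sum_i `|c i| + 1.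
have C0 : 0 < C by rewrite ltr_wpDl// sumr_ge0.
have [r r0 Sr] := Sb_continuous (divr_gt0 eps0 C0).
(* [eta <= tau i] keeps the [i]-th interval inside []0, T[]; [eta <= r] makes the orbit vary by at
   most [eps / C] along it. *)
have [eta eta0 [eta_r eta_tau]] : exists2 eta : R, 0 < eta & eta <= r /\
    forall i, eta <= tau i.
  exists (\big[Num.min/r]_i tau i).
    by apply: lt_bigmin => // i _; have /andP[] := tauT i.
  by split; [exact: bigmin_le_id|move=> i; exact: bigmin_le_cond].
pose D : set (measurableTypeR R) := `]0, T[%classic.
have mD : measurable D by exact: measurable_itv.
have fD : (lebesgue_measure D < +oo)%E.
  by rewrite lebesgue_measure_itv/=; case: ifP => _; rewrite -?EFinB ltry.
pose J (i : 'I_n) : set (measurableTypeR R) := `]T - tau i, T - tau i + eta[%classic.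
have mJ i : measurable (J i) by exact: measurable_itv.
have DJ i : fine (lebesgue_measure (D `&` J i)) = eta.
  rewrite setIidr; last first.
    move=> x; rewrite /D /J /= !in_itv/= => /andP[x1 x2].
    have := eta_tau i; have /andP[_] := tauT i; move: x1 x2; lra.
  rewrite lebesgue_measure_itv/= lte_fin ltrDl eta0 -EFinB/=; ring.
pose a i := c i / eta.
pose u := step_control T a mJ.
have uE x : u x = \sum_i a i * \1_(J i) x by exact: step_controlE.
have /choice[y yP] : forall t, exists y, 0 <= t <= T ->
    is_bochner_integral `]0, t[ (fun s => S (t - s) (u s *: b)) y.
  move=> t; have [tT|] := boolP (0 <= t <= T); last by exists 0.
  by have [y ?] := bochner_step_orbit mJ uE tT; exists y.
exists u, (fun t => S t z0 + y t); split.
  move=> t tT; exists (y t); split; first exact: yP.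
  by apply: nearW => x _.
have TT : 0 <= T <= T by rewrite T0 lexx.
have [sm [smE smI]] := @simple_map_of_family D 'I_n J
  (fun i => a i *: S (tau i) b) mD fD mJ.
have smv : sm_integral sm = orbit_comb (fun t => S t b) s.
  rewrite smI /orbit_comb [in RHS](big_tnth)/=; apply: eq_bigr => i _.
  by rewrite DJ scalerA /a mulrC divfK// gt_eqF.
(* This step function dominates the error made by freezing the orbit at [tau i] on [J i]; its
   integral is the sum of the [|c i| * (eps / C)], at most [eps]. *)
have [ih hI] := step_integral mD (fun i => `|a i| * (eps / C)) mJ
  (fun i => le_lt_trans (le_measure _ (mem_set (measurableI _ _ mD (mJ i)))
     (mem_set mD) (@subIsetl _ D (J i))) fD).
have ysm : nrm (y T - sm_integral sm) <= eps.
  apply: le_trans (bochner_dist_simple mD (yP T TT) ih _) _.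
    move=> x; rewrite /D/= in_itv/= => /andP[x0 xT].
    have Tx : 0 <= T - x by rewrite subr_ge0 ltW.
    have -> : nrm (S (T - x) (u x *: b) - sm_eval sm x) =
        nrm (\sum_i (a i * \1_(J i) x) *: (S (T - x) b - S (tau i) b)).
      apply: snorm_eq => w; rewrite innerBl inner_semigroupZ// smE uE !inner_suml.
      rewrite mulr_suml -sumrB; apply: eq_bigr => i _.
      by rewrite !innerZl innerBl; ring.
    apply: le_trans (snorm_sum _ _ _) _; apply: ler_sum => i _.
    rewrite snormZ normrM -[leLHS]mulrA -[leRHS]mulrA ler_wpM2l// indicE.
    have [xJ|_] := boolP (x \in J i); last by rewrite normr0 mul0r mulr0.
    rewrite normr1 mul1r mulr1 snorm_distC; move: xJ.
    rewrite inE /J/= in_itv/= => /andP[x1 x2]; have /andP[tau0 tauT'] := tauT i.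
    apply: Sr => //; [lra|exact: ltW|].
    by apply: lt_le_trans eta_r; lra.
  rewrite hI.
  under eq_bigr => i _ do rewrite DJ /a normrM normfV (gtr0_norm eta0) mulrAC
    divfK ?gt_eqF//.
  rewrite -mulr_suml mulrCA ger_pMr// ler_pdivrMr// mul1r /C lerDl//.
rewrite (_ : S T z0 + y T - z1 = (y T - sm_integral sm) -
    (z1 - S T z0 - sm_integral sm)).
  apply: le_trans (snormB _ _ _) _; apply: lerD; first exact: ysm.
  rewrite smv; exact: zs.
by rewrite !opprB addrA subrK addrCA addrA.
Qed.
End orbit_integrals.

(** * Controllability with a one-dimensional control *)

Section controllability.
Context d (X : measurableType d) (R : realType) (mu : {measure set X -> \bar R}).
Local Notation H := (L2 mu).
Local Notation dot := (L2_inner mu).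
Local Notation nrm := (snorm dot).
Variables (S : R -> H -> H) (A : H -> H -> Prop) (m : nat -> R) (e : nat -> H).
Variables (T : R) (b : H).
Hypothesis T0 : 0 < T.
Hypothesis Sg : C0_semigroup S.
Hypothesis SA : generated_by S A.
Hypothesis A_simple : forall l, is_eigenvalue A l -> is_simple_eigenvalue A l.
Hypothesis e_basis : hilbert_basis e.
Hypothesis e_eigen : forall j, is_eigenfunction A (m j) (e j).

Let m_simple j : is_simple_eigenvalue A (m j).
Proof. by apply: A_simple; exists (e j). Qed.

Let coord t f j : 0 <= t -> dot (S t f) (e j) = expR (m j * t) * dot f (e j).
Proof. exact: (semigroup_coord Sg SA e_basis e_eigen m_simple). Qed.

Lemma controllable_coord_neq0 j :
  approximately_controllable S (fun c => c *: b) T -> dot b (e j) != 0.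
Proof.
move=> AC; apply/eqP => bj0.
have half0 : 0 < 2^-1 :> R by rewrite invr_gt0.
(* From the initial state 0 the [j]-th coordinate would stay 0, at distance 1 from that of [e j];
   any tolerance below 1 gives the contradiction. *)
have [u [z [zmild zT]]] := AC 0 (e j) 2^-1 half0.
have TT : 0 <= T <= T by rewrite ltW//= lexx.
have [y [yint zE]] := zmild T TT.
have y0 : dot y (e j) = 0.
  apply: (bochner_inner0 _ yint) => [|s]; first exact: measurable_itv.
  rewrite /= in_itv/= => /andP[s0 sT].
  by rewrite coord ?subr_ge0 ?(ltW sT)// innerZl bj0 !mulr0.
move: zT; rewrite L2normE => zT.
have := le_trans (cauchy_schwarz dot (z T - e j) (e j)) (ler_wpM2r (snorm_ge0 _ _) zT).
rewrite (snorm_basis (basis_orthonormal e_basis)) mulr1 innerBl.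
rewrite (inner_ae _ zE) innerDl y0 (coord _ _ (ltW T0)) inner0l mulr0.
rewrite (basis_orthonormal e_basis) eqxx add0r sub0r normrN1; lra.
Qed.

Lemma coord_neq0_controllable : (forall j, dot b (e j) != 0) ->
  approximately_controllable S (fun c => c *: b) T.
Proof.
move=> bn0 z0 z1 eps eps0; have e20 : 0 < eps / 2 by rewrite divr_gt0.
have [M mM] := eigenvalues_bounded Sg SA e_basis e_eigen m_simple.
(* The target is what remains after the free evolution of [z0]; half of [eps] goes to density and
   half to the concentration of the control. *)
have [s [sT zs]] := orbit_limit_all (basis_orthonormal e_basis)
  (basis_total e_basis) (eigenvalues_inj e_basis e_eigen m_simple) mM bn0
  (fun t j => @coord t b j) (z1 - S T z0) T0 e20.
have Sb (r : R) := @semigroup_uniformly_continuous _ _ _ _ _ Sg _ SA _ _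
  e_basis e_eigen m_simple T b r.
have [u [z [zm zT]]] := steer_orbit_comb Sg Sb (ltW T0) e20 sT zs.
by exists u, z; split=> //; rewrite L2normE (splitr eps).
Qed.
End controllability.

Theorem mainTheorem5 (R : realType) (n : nat) (Omega : smooth_domain R n)
  (omega : set 'rV[R]_n) (omega_open : open omega)
  (omega_sub : omega `<=` Omega) (T : R) (T_gt0 : 0 < T)
  (S : R -> L2 (lebesgue_on Omega) -> L2 (lebesgue_on Omega))
  (S_semigroup : C0_semigroup S)
  (S_generated : generated_by S (dirichlet_laplacian Omega))
  (all_simple : forall lambda : R,
     is_eigenvalue (dirichlet_laplacian Omega) lambda ->
     is_simple_eigenvalue (dirichlet_laplacian Omega) lambda)
  (mu : nat -> R) (phi : nat -> L2 (lebesgue_on Omega))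
  (phi_basis : hilbert_basis phi)
  (phi_eigen : forall j,
     is_eigenfunction (dirichlet_laplacian Omega) (mu j) (phi j)) :
  approximately_controllable S (lumped_control omega_open omega_sub) T <->
  forall j, \int[lebesgue_rV R n]_(x in omega) phi j x != 0.
Proof.
pose b := L2_indic omega_open omega_sub.
have mo := open_measurable_rV omega_open.
have bE j : L2_inner _ b (phi j) = \int[lebesgue_rV R n]_(x in omega) phi j x.
  rewrite /inner/= /L2dot/=.
  rewrite (_ : (fun x => _) = (phi j : _ -> R) \_ omega); last first.
    apply/funext => x; rewrite patchE.
    change (\1_omega x * phi j x = if x \in omega then phi j x else 0).
    rewrite indicE.
    by case: ifP => _; rewrite ?mul1r ?mul0r.
  rewrite -Rintegral_mkcond /Rintegral; congr fine.
  (* Restricting the measure to [Omega] changes nothing on subsets of [omega], since [omega] lies in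
     [Omega]. *)
  apply: eq_measure_integral => B mB Bo.
  change (lebesgue_rV R n (B `&` Omega) = lebesgue_rV R n B).
  by rewrite setIidl//; exact: subset_trans Bo omega_sub.
split=> [AC j|bn0].
  rewrite -bE; exact: (controllable_coord_neq0 T_gt0 S_semigroup S_generated
    all_simple phi_basis phi_eigen j AC).
apply: (coord_neq0_controllable T_gt0 S_semigroup S_generated all_simple
  phi_basis phi_eigen (b := b)) => j.
by rewrite bE.
Qed.
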